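(* Let $\kappa$ be a regular uncountable cardinal. The following are equivalent: (1) There is a $\square^*_{<}(\kappa)$-sequence $\vec C$ such that $R'(\vec C)\cap V'(\vec C)$ contains a club in $\kappa$; (2) $\square^*_{<}(\kappa)$ holds; (3) There is a special $\kappa$-Aronszajn tree.
   Context: A $C$-sequence over $\kappa$ is $\vec C=\langle C_\delta\mid\delta<\kappa\rangle$, each $C_\delta$ a closed subset of $\delta$ with $\sup(C_\delta)=\sup(\delta)$. It is weakly coherent if $|\{C_\delta\cap\epsilon\mid\delta<\kappa\}|<\kappa$ for every $\epsilon<\kappa$. $\mathrm{acc}(\kappa)$: nonzero limit ordinals below $\kappa$; for a set of ordinals $A$, $\mathrm{acc}(A)=\{\alpha\in A\mid\sup(A\cap\alpha)=\alpha>0\}$, $\mathrm{nacc}(A)=A\setminus\mathrm{acc}(A)$. $R(\vec C)=\{\delta\in\mathrm{acc}(\kappa)\mid\forall\alpha\in(\delta,\kappa)\,[\mathrm{otp}(C_\alpha\cap\delta)<\delta]\}$; $R'(\vec C)=\{\delta\in R(\vec C)\mid\mathrm{otp}(C_\delta)<\delta\}$; $V'(\vec C)=\{\delta\in\mathrm{acc}(\kappa)\mid\forall\alpha\in(\delta,\kappa)\,[\sup(\mathrm{nacc}(C_\delta)\cap\mathrm{nacc}(C_\alpha))<\delta]\}$. A $\square^*_{<}(\kappa)$-sequence is a weakly coherent $C$-sequence $\vec C$ over $\kappa$ such that $R(\vec C)$ contains a club; $\square^*_{<}(\kappa)$ asserts that one exists. A $\kappa$-tree is a tree of height $\kappa$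 with levels of size $<\kappa$; $\kappa$-Aronszajn means no chain of size $\kappa$; a $\kappa$-tree $(T,<_T)$ is special iff there is $f:T\to T$ with $f(x)<_Tx$ for non-minimal $x$ and each $f^{-1}\{z\}$ covered by fewer than $\kappa$ antichains. *)

(* Defs.v *)
(* plain Prop-valued set theory on a well-ordered type K
   representing the regular uncountable cardinal kappa (its elements are the
   ordinals below kappa, ordered by lt). *)
From Stdlib Require Import Classical.

Section Ord.
Variables (K : Type) (lt : K -> K -> Prop).

Definition le (x y : K) : Prop := lt x y \/ x = y.

Definition well_order : Prop :=
  (forall x, ~ lt x x) /\
  (forall x y z, lt x y -> lt y z -> lt x z) /\
  (forall x y, lt x y \/ x = y \/ lt y x) /\
  well_founded lt.

(* |A| < kappa: A injects into some proper initial segment {b | b < a} *)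
Definition small {X : Type} (A : X -> Prop) : Prop :=
  exists (a : K) (f : X -> K),
    (forall x, A x -> lt (f x) a) /\
    (forall x y, A x -> A y -> f x = f y -> x = y).

Definition bounded (A : K -> Prop) : Prop :=
  exists a, forall x, A x -> lt x a.

Definition regular_uncountable : Prop :=
  well_order /\
  (forall A : K -> Prop, small A -> bounded A) /\
  ~ (exists f : K -> nat, forall x y, f x = f y -> x = y).

Definition acc_pt (A : K -> Prop) (g : K) : Prop :=
  (exists x, lt x g) /\
  (forall b, lt b g -> exists x, A x /\ lt b x /\ lt x g).

Definition acc_kappa (d : K) : Prop := acc_pt (fun _ => True) d.

Definition accS (A : K -> Prop) (x : K) : Prop := A x /\ acc_pt A x.
Definition naccS (A : K -> Prop) (x : K) : Prop := A x /\ ~ acc_pt A x.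

Definition upper_bound (A : K -> Prop) (g : K) : Prop :=
  forall x, A x -> le x g.

(* sup A = sup B (same upper bounds in kappa; both may be kappa) *)
Definition same_sup (A B : K -> Prop) : Prop :=
  forall g, upper_bound A g <-> upper_bound B g.

Definition sup_lt (A : K -> Prop) (d : K) : Prop :=
  exists b, lt b d /\ upper_bound A b.

Definition otp_lt (A : K -> Prop) (d : K) : Prop :=
  exists b, lt b d /\ exists f : K -> K,
    (forall x, A x -> lt (f x) b) /\
    (forall x y, A x -> A y -> lt x y -> lt (f x) (f y)) /\
    (forall g, lt g b -> exists x, A x /\ f x = g).

Definition inter (A B : K -> Prop) (x : K) : Prop := A x /\ B x.
Definition below (d : K) (x : K) : Prop := lt x d.

Definition club (D : K -> Prop) : Prop :=
  (forall a, exists b, D b /\ lt a b) /\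
  (forall g, acc_pt D g -> D g).

Definition contains_club (X : K -> Prop) : Prop :=
  exists D, club D /\ forall x, D x -> X x.

Definition C_sequence (C : K -> K -> Prop) : Prop :=
  forall d,
    (forall x, C d x -> lt x d) /\
    (forall g, lt g d -> acc_pt (C d) g -> C d g) /\
    same_sup (C d) (below d).

Definition weakly_coherent (C : K -> K -> Prop) : Prop :=
  forall e, exists (a : K) (h : K -> K),
    (forall d, lt (h d) a) /\
    (forall d d', h d = h d' ->
        forall x, (C d x /\ lt x e) <-> (C d' x /\ lt x e)).

Definition R_set (C : K -> K -> Prop) (d : K) : Prop :=
  acc_kappa d /\ forall a, lt d a -> otp_lt (inter (C a) (below d)) d.

Definition R'_set (C : K -> K -> Prop) (d : K) : Prop :=
  R_set C d /\ otp_lt (C d) d.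

Definition V'_set (C : K -> K -> Prop) (d : K) : Prop :=
  acc_kappa d /\
  forall a, lt d a -> sup_lt (inter (naccS (C d)) (naccS (C a))) d.

Definition square_lt_seq (C : K -> K -> Prop) : Prop :=
  C_sequence C /\ weakly_coherent C /\ contains_club (R_set C).

Definition square_lt : Prop := exists C, square_lt_seq C.

Section Tree.
Variables (T : Type) (ltT : T -> T -> Prop).

Definition on_level (x : T) (a : K) : Prop :=
  exists f : T -> K,
    (forall y, ltT y x -> lt (f y) a) /\
    (forall y z, ltT y x -> ltT z x -> ltT y z -> lt (f y) (f z)) /\
    (forall y z, ltT y x -> ltT z x -> f y = f z -> y = z) /\
    (forall g, lt g a -> exists y, ltT y x /\ f y = g).

Definition kappa_tree : Prop :=
  (forall x, ~ ltT x x) /\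
  (forall x y z, ltT x y -> ltT y z -> ltT x z) /\
  (forall x y z, ltT y x -> ltT z x -> ltT y z \/ y = z \/ ltT z y) /\
  (forall x, exists a, on_level x a) /\
  (forall a, exists x, on_level x a) /\
  (forall a, small (fun x => on_level x a)).

Definition chain (B : T -> Prop) : Prop :=
  forall x y, B x -> B y -> ltT x y \/ x = y \/ ltT y x.

Definition antichain (A : T -> Prop) : Prop :=
  forall x y, A x -> A y -> x <> y -> ~ ltT x y /\ ~ ltT y x.

Definition aronszajn : Prop :=
  kappa_tree /\
  ~ exists (B : T -> Prop) (f : K -> T),
      chain B /\ (forall a, B (f a)) /\ (forall a b, f a = f b -> a = b).

Definition special : Prop :=
  kappa_tree /\
  exists f : T -> T,
    (forall x, (exists y, ltT y x) -> ltT (f x) x) /\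
    (forall z, exists (a : K) (A : K -> T -> Prop),
        (forall b, lt b a -> antichain (A b)) /\
        (forall x, f x = z -> exists b, lt b a /\ A b x)).
End Tree.

End Ord.

(* Main.v *)
(* A special tree has a map F that is regressive on the levels of a club D and takes
   distinct values at comparable nodes of these levels.

   From F to a square sequence: fix a node x on each level d of D and let m(e) be the least
   value of F on the part of the branch of x between e and d. The points of D at which m
   increases form a closed cofinal subset of d whose trace on e depends only on the
   restriction of x to level e and on m(e) < e, which gives weak coherence; m embeds the
   trace into m(e) + 1, which bounds its order type. If d has cofinality omega, a cofinal
   omega-sequence in D is used instead; otherwise m is bounded below d. For V', the
   non-limit points are replaced by codes of (restriction of x, F(x)). This separates
   C_d from C_a provided that nodes on limit levels are determined by their predecessors.

   From a square sequence to a tree with this property: the nodes on level a are the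
   classes of ordinals b >= a whose walks to all e < a leave the same traces. Weak
   coherence bounds the levels, and F(x) codes the order types along the walk from b to a,
   which are below a for a in R(C), together with otp(C_a) if it is below a. *)
From Stdlib Require Import Classical ClassicalEpsilon FunctionalExtensionality List Lia.
Import ListNotations.
Require Import Defs.

Lemma func_choice {A B : Type} (R : A -> B -> Prop) :
  (forall x, exists y, R x y) -> exists f : A -> B, forall x, R x (f x).
Proof.
  intros H.
  exists (fun x => proj1_sig (constructive_indefinite_description _ (H x))).
  intros x. exact (proj2_sig (constructive_indefinite_description _ (H x))).
Qed.

Lemma func_choice_on {A B : Type} (b0 : B) (P : A -> Prop) (R : A -> B -> Prop) :
  (forall x, P x -> exists y, R x y) -> exists f : A -> B, forall x, P x -> R x (f x).
Proof.
  intros H. apply (func_choice (fun x y => P x -> R x y)).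
  intros x. destruct (classic (P x)) as [Px|Px].
  - destruct (H x Px) as [y Hy]. exists y. auto.
  - exists b0. tauto.
Qed.

Section Kappa.
Variables (K : Type) (lt : K -> K -> Prop).
Hypothesis HK : regular_uncountable K lt.

Local Infix "<<" := lt (at level 70).
Local Notation "x <<= y" := (le K lt x y) (at level 70).
Local Notation acc_pt := (acc_pt K lt).
Local Notation acc_kappa := (acc_kappa K lt).
Local Notation bounded := (bounded K lt).
Local Notation small := (small K lt).
Local Notation club := (club K lt).

(** * Ordinals below kappa *)

Lemma lt_irr x : ~ x << x.
Proof. apply (proj1 (proj1 HK)). Qed.

Lemma lt_trans x y z : x << y -> y << z -> x << z.
Proof. apply (proj1 (proj2 (proj1 HK))). Qed.

Lemma lt_total x y : x << y \/ x = y \/ y << x.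
Proof. apply (proj1 (proj2 (proj2 (proj1 HK)))). Qed.

Lemma lt_wf : well_founded lt.
Proof. apply (proj2 (proj2 (proj2 (proj1 HK)))). Qed.

Lemma regular (A : K -> Prop) : small A -> bounded A.
Proof. apply (proj1 (proj2 HK)). Qed.

Lemma le_refl x : x <<= x.
Proof. right; reflexivity. Qed.

Lemma lt_le x y : x << y -> x <<= y.
Proof. left; assumption. Qed.

Lemma le_lt_trans x y z : x <<= y -> y << z -> x << z.
Proof. intros [H| ->] ?; [eapply lt_trans; eauto|assumption]. Qed.

Lemma lt_le_trans x y z : x << y -> y <<= z -> x << z.
Proof. intros ? [H| <-]; [eapply lt_trans; eauto|assumption]. Qed.

Lemma le_trans x y z : x <<= y -> y <<= z -> x <<= z.
Proof. intros [H| ->] ?; [left; eapply lt_le_trans; eauto|assumption]. Qed.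

Lemma not_lt x y : ~ x << y -> y <<= x.
Proof. intros H. destruct (lt_total x y) as [|[->|]]; [tauto|apply le_refl|now left]. Qed.

Lemma not_le x y : ~ x <<= y -> y << x.
Proof.
  intros H. destruct (lt_total x y) as [|[->|]]; [|destruct H; apply le_refl|assumption].
  destruct H; now left.
Qed.

Lemma le_antisym x y : x <<= y -> y <<= x -> x = y.
Proof. intros [H|H] [H'|H']; auto. destruct (lt_irr x). eapply lt_trans; eauto. Qed.

Ltac addh t T := lazymatch goal with _ : T |- _ => fail | _ => pose proof (t : T) end.

(* Decides goals and contexts about [<<], [<<=] and [=] by saturation. *)
Ltac ord :=
  intros;
  try match goal with
  | |- _ << _ => apply NNPP; intro
  | |- _ <<= _ => apply NNPP; intro
  | |- @eq K _ _ => apply le_antisym; apply NNPP; intro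
  | |- ~ _ => intro
  | |- False => idtac
  end;
  repeat match goal with
  | H : ~ (_ << _) |- _ => apply not_lt in H
  | H : ~ (_ <<= _) |- _ => apply not_le in H
  end;
  repeat match goal with
  | H : @eq K ?x ?y |- _ =>
      pose proof (or_intror H : x <<= y); pose proof (or_intror (eq_sym H) : y <<= x); clear H
  end;
  repeat match goal with
    | H : ?x << ?x |- _ => exfalso; exact (lt_irr x H)
    | H1 : ?x << ?y, H2 : ?y << ?z |- _ => addh (lt_trans x y z H1 H2) (x << z)
    | H1 : ?x << ?y, H2 : ?y <<= ?z |- _ => addh (lt_le_trans x y z H1 H2) (x << z)
    | H1 : ?x <<= ?y, H2 : ?y << ?z |- _ => addh (le_lt_trans x y z H1 H2) (x << z)
    | H1 : ?x <<= ?y, H2 : ?y <<= ?z |- _ => addh (le_trans x y z H1 H2) (x <<= z)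
    end; fail.

Lemma least (P : K -> Prop) :
  (exists x, P x) -> exists x, P x /\ forall y, P y -> x <<= y.
Proof.
  intros [x Px]. revert Px. induction (lt_wf x) as [x _ IH]. intros Px.
  destruct (classic (exists y, P y /\ y << x)) as [(y & Py & Hy)|H].
  - eauto.
  - exists x. split; [assumption|]. intros y Py. apply not_lt. intro. eauto.
Qed.

Lemma K_inh : exists x : K, True.
Proof.
  apply NNPP. intro H. apply (proj2 (proj2 HK)). exists (fun _ => 0).
  intros x. destruct H; eauto.
Qed.

Lemma zero_ex : exists z, forall x, z <<= x.
Proof.
  destruct K_inh as [k _]. destruct (least (fun _ => True)) as (z & _ & Hz); eauto.
Qed.

(** If something lies below [a], the singleton of [a] is small, hence bounded. Otherwise a maximal
    [a] would be the only element, against uncountability. *)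
Lemma no_max a : exists b, a << b.
Proof.
  apply NNPP. intro H.
  destruct (classic (exists b, b << a)) as [[b Hb]|H'].
  - destruct (regular (fun x => x = a)) as [c Hc].
    + exists a, (fun _ => b). split; [auto|intros; congruence].
    + destruct H. exists c. auto.
  - apply (proj2 (proj2 HK)). exists (fun _ => 0). intros x y _.
    destruct (lt_total x a) as [|[->|]]; [exfalso; eauto| |exfalso; eauto].
    destruct (lt_total y a) as [|[->|]]; [exfalso; eauto|auto |exfalso; eauto].
Qed.

Lemma max2 a b : exists c, a << c /\ b << c.
Proof.
  destruct (classic (a << b)) as [H|H].
  - destruct (no_max b) as [c Hc]. exists c. split; ord.
  - destruct (no_max a) as [c Hc]. exists c. split; ord.
Qed.

(* [tame P] is the working form of "|P| < kappa": unlike [small], it passes to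
   unions and products without any cardinal arithmetic. *)
Definition tame {X : Type} (P : X -> Prop) : Prop :=
  forall g : X -> K, exists a, forall x, P x -> g x << a.

(** Choosing a preimage for each value shows that the image of [P] under [g] is again small, so
    regularity bounds it. *)
Lemma tame_of_small {X : Type} (P : X -> Prop) : small P -> tame P.
Proof.
  intros (a & f & Hf & Hi) g.
  destruct (classic (exists x, P x)) as [[x0 _]|HN].
  2:{ exists a. intros x Px. destruct HN; eauto. }
  destruct (func_choice_on x0 (fun k => exists x, P x /\ g x = k)
     (fun k x => P x /\ g x = k)) as [c Hc]; [auto|].
  destruct (regular (fun k => exists x, P x /\ g x = k)) as [b Hb].
  - exists a, (fun k => f (c k)). split.
    + intros k Hk. apply Hf, (Hc k Hk).
    + intros k k' Hk Hk' E. destruct (Hc k Hk) as [H1 H2], (Hc k' Hk') as [H3 H4].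
      apply Hi in E; congruence.
  - exists b. intros x Px. apply Hb. eauto.
Qed.

Lemma tame_below a : tame (fun x => x << a).
Proof. apply tame_of_small. exists a, (fun x => x). auto. Qed.

Lemma tame_le a : tame (fun x => x <<= a).
Proof.
  destruct (no_max a) as [b Hb]. intros g. destruct (tame_below b g) as [c Hc].
  exists c. intros x Hx. apply Hc. ord.
Qed.

Lemma tame_sub {X : Type} (P Q : X -> Prop) :
  tame Q -> (forall x, P x -> Q x) -> tame P.
Proof. intros HQ H g. destruct (HQ g) as [a Ha]. exists a. auto. Qed.

Lemma tame_Union {I X : Type} (J : I -> Prop) (P : I -> X -> Prop) :
  tame J -> (forall i, J i -> tame (P i)) -> tame (fun x => exists i, J i /\ P i x).
Proof.
  intros HJ HP g. destruct K_inh as [k0 _].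
  destruct (func_choice_on k0 J (fun i a => forall x, P i x -> g x << a)) as [b Hb].
  { intros i Hi. apply HP; assumption. }
  destruct (HJ b) as [a Ha]. exists a. intros x (i & Hi & Hx).
  specialize (Ha i Hi). specialize (Hb i Hi x Hx). ord.
Qed.

Lemma tame_image {X Y : Type} (P : X -> Prop) (f : X -> Y) :
  tame P -> tame (fun y => exists x, P x /\ y = f x).
Proof.
  intros HP g. destruct (HP (fun x => g (f x))) as [a Ha]. exists a.
  intros y (x & Hx & ->). auto.
Qed.

Lemma tame_pair {X Y : Type} (P : X -> Prop) (Q : Y -> Prop) :
  tame P -> tame Q -> tame (fun p : X * Y => P (fst p) /\ Q (snd p)).
Proof.
  intros HP HQ.
  apply tame_sub with (fun p => exists x, P x /\ exists y, Q y /\ p = (x, y)).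
  - apply tame_Union; [assumption|]. intros x _. now apply tame_image.
  - intros [x y] [Hx Hy]. exists x. split; [assumption|]. exists y. auto.
Qed.

Lemma succ_ex a : exists b, a << b /\ forall c, a << c -> b <<= c.
Proof. apply least, no_max. Qed.

(** This is uncountable cofinality. The finite ordinals are either bounded, which makes the index
    set small, or they exhaust [K]. *)
Lemma tame_nat : tame (fun _ : nat => True).
Proof.
  destruct (func_choice _ succ_ex) as [s Hs]. destruct zero_ex as [z Hz].
  set (w := fun n => Nat.iter n s z).
  assert (w_mono : forall n m, n < m -> w n << w m).
  { intros n m Hnm. induction Hnm as [|m Hnm IH]; cbn; [apply Hs|].
    eapply lt_trans; [exact IH|apply Hs]. }
  assert (w_inj : forall n m, w n = w m -> n = m).
  { intros n m E. destruct (PeanoNat.Nat.lt_trichotomy n m) as [H|[H|H]]; auto;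
      apply w_mono in H; ord. }
  apply tame_of_small.
  destruct (classic (exists a, forall n, w n << a)) as [[a Ha]|HN].
  { exists a, w. auto. }
  exfalso.
  (* otherwise [w] would enumerate K *)
  assert (surj : forall x, exists n, w n = x).
  { intros x. apply NNPP. intros Hx. apply HN. exists x. induction n as [|n IH].
    - destruct (Hz x) as [H|H]; [exact H|]. destruct Hx. now exists 0.
    - destruct (proj2 (Hs (w n)) x IH) as [H|H]; [exact H|]. destruct Hx. now exists (S n). }
  apply (proj2 (proj2 HK)). destruct (func_choice _ surj) as [f Hf].
  exists f. intros x y E. rewrite <- (Hf x), <- (Hf y). now rewrite E.
Qed.

Lemma tame_lists {X : Type} (P : X -> Prop) :
  tame P -> tame (fun l : list X => Forall P l).
Proof.
  intros HP.
  apply tame_sub with (fun l => exists n : nat, True /\ (length l = n /\ Forall P l)).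
  2:{ intros l Hl. eauto. }
  apply tame_Union; [apply tame_nat|]. intros n _. induction n as [|n IH].
  - apply tame_sub with (fun l => l = []).
    + intros g. destruct (no_max (g [])) as [b Hb]. exists b. intros l ->. exact Hb.
    + intros [|] [H _]; [reflexivity|discriminate].
  - eapply tame_sub; [apply (tame_image _ (fun p : X * list X => fst p :: snd p)
      (tame_pair _ _ HP IH))|].
    intros [|x l] [H1 H2]; [discriminate|]. inversion H2; subst.
    exists (x, l). cbn in *. repeat split; auto.
Qed.

Lemma sup_seq (s : nat -> K) :
  (forall n, s n << s (S n)) ->
  exists g, (forall n, s n << g) /\ forall b, b << g -> exists n, b << s n.
Proof.
  intros Hs. destruct (least (fun g => forall n, s n << g)) as (g & Hg & Hl).
  { destruct (tame_nat s) as [a Ha]. eauto. }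
  exists g. split; [exact Hg|]. intros b Hb. apply NNPP. intros HN.
  assert (H : g <<= b); [|ord].
  apply Hl. intros n. assert (~ b << s (S n)) by eauto. specialize (Hs n). ord.
Qed.

Lemma seq_le (s : nat -> K) n m : (forall n, s n << s (S n)) -> n <= m -> s n <<= s m.
Proof.
  intros Hs H. induction H as [|m H IH]; [apply le_refl|]. specialize (Hs m). ord.
Qed.

(** Well-founded recursion that takes the least admissible value, kept below kappa by tameness of
    the predecessors. It serves both to rank pairs and to collapse sets of ordinals onto their order
    types. *)
Lemma rank_ex {X : Type} (R : X -> X -> Prop) (l : X -> K) :
  well_founded R -> (forall x, tame (fun y => R y x)) ->
  exists g : X -> K, forall x, l x <<= g x /\ (forall y, R y x -> g y << g x) /\
    forall k, l x <<= k -> (forall y, R y x -> g y << k) -> g x <<= k.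
Proof.
  intros wf HR. destruct K_inh as [k0 _].
  set (ok := fun x (rec : forall y, R y x -> K) k => l x <<= k /\ forall y h, rec y h << k).
  set (F := fun x rec => epsilon (inhabits k0)
    (fun k => ok x rec k /\ forall k', ok x rec k' -> k <<= k')).
  set (g := Fix wf (fun _ => K) F). exists g. intros x.
  assert (Eg : g x = F x (fun y _ => g y)).
  { apply (Fix_eq wf (fun _ => K) F). intros x' f f' E.
    replace f' with f; [reflexivity|].
    apply functional_extensionality_dep; intro y.
    apply functional_extensionality_dep; intro h. apply E. }
  assert (H : ok x (fun y _ => g y) (g x) /\ forall k, ok x (fun y _ => g y) k -> g x <<= k).
  { rewrite Eg. apply epsilon_spec. apply least.
    destruct (HR x g) as [a Ha]. destruct (max2 a (l x)) as (c & H1 & H2).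
    exists c. split; [ord|]. intros y h. specialize (Ha y h). ord. }
  destruct H as [[H1 H2] H3]. repeat split; [exact H1|exact H2|].
  intros k Hk1 Hk2. apply H3. split; auto.
Qed.

(** Goedel's ordering: by maximum, then lexicographically. Ranks start at [s (mx p)], which exceeds
    both coordinates; totality of the ordering makes the rank injective. *)
Lemma pairing_ex : exists pr : K -> K -> K,
  (forall a b, a << pr a b /\ b << pr a b) /\
  (forall a b a' b', pr a b = pr a' b' -> a = a' /\ b = b').
Proof.
  destruct (func_choice (fun (p : K * K) m => fst p <<= m /\ snd p <<= m /\
    (m = fst p \/ m = snd p))) as [mx Hmx].
  { intros [a b]; cbn. destruct (classic (a << b)) as [H|H];
      [exists b|exists a]; (split; [|split]); auto; ord. }
  set (R := fun q p : K * K => mx q << mx p \/ mx q = mx p /\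
    (fst q << fst p \/ fst q = fst p /\ snd q << snd p)).
  assert (wf : well_founded R).
  { assert (H : forall m a b, mx (a, b) = m -> Acc R (a, b)).
    { intros m. induction (lt_wf m) as [m _ IHm].
      intros a. induction (lt_wf a) as [a _ IHa].
      intros b. induction (lt_wf b) as [b _ IHb]. intros Em.
      constructor. intros [a' b'] [H|[E [H|[E' H]]]]; cbn in *.
      - eapply IHm; [|reflexivity]. now rewrite <- Em.
      - apply IHa; [exact H|congruence].
      - subst a'. apply IHb; [exact H|congruence]. }
    intros [a b]. eapply H. reflexivity. }
  destruct (func_choice _ no_max) as [s Hs].
  destruct (rank_ex R (fun p => s (mx p)) wf) as [g Hg].
  { intros p. eapply tame_sub; [apply (tame_pair _ _ (tame_le (mx p)) (tame_le (mx p)))|].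
    intros q Hq. destruct (Hmx q) as (H1 & H2 & _).
    assert (mx q <<= mx p) by (destruct Hq as [Hq|[Hq _]]; ord). split; ord. }
  exists (fun a b => g (a, b)). split.
  - intros a b. destruct (Hmx (a, b)) as (H1 & H2 & _). destruct (Hg (a, b)) as [H3 _].
    specialize (Hs (mx (a, b))). cbn in *. split; ord.
  - intros a b a' b' E.
    assert (H : forall p q, R p q -> g p = g q -> False).
    { intros p q Hpq E'. destruct (Hg q) as (_ & Hq & _). specialize (Hq p Hpq). ord. }
    assert (tot : (a, b) = (a', b') \/ R (a, b) (a', b') \/ R (a', b') (a, b)).
    { unfold R; cbn. destruct (lt_total (mx (a, b)) (mx (a', b'))) as [|[|]]; auto.
      destruct (lt_total a a') as [|[|]]; auto 6.
      destruct (lt_total b b') as [|[|]]; auto 7. left. congruence. }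
    destruct tot as [T|[T|T]].
    + inversion T; auto.
    + destruct (H _ _ T E).
    + destruct (H _ _ T (eq_sym E)).
Qed.

(** * Limit ordinals, codes of lists, and clubs *)

Lemma acc_pt_lim A g : acc_pt A g -> acc_kappa g.
Proof.
  intros [H1 H2]. split; [exact H1|]. intros b Hb. destruct (H2 b Hb) as (x & _ & Hx). eauto.
Qed.

Lemma lim_gt d b : acc_kappa d -> b << d -> exists c, b << c /\ c << d.
Proof. intros [_ H] Hb. destruct (H b Hb) as (x & _ & Hx). eauto. Qed.

Lemma lim_gt2 d a b : acc_kappa d -> a << d -> b << d -> exists c, a << c /\ b << c /\ c << d.
Proof.
  intros Hd Ha Hb. destruct (classic (a << b)) as [H|H].
  - destruct (lim_gt d b Hd Hb) as (c & H1 & H2). exists c. repeat split; ord.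
  - destruct (lim_gt d a Hd Ha) as (c & H1 & H2). exists c. repeat split; ord.
Qed.

Lemma list_bound d l : acc_kappa d -> Forall (fun o => o << d) l ->
  exists e, e << d /\ Forall (fun o => o <<= e) l.
Proof.
  intros Hd Hl. induction Hl as [|o l Ho _ (e & He1 & He2)].
  - destruct (proj1 Hd) as [e He]. exists e. auto.
  - destruct (lim_gt2 d o e Hd Ho He1) as (e' & H1 & H2 & H3). exists e'.
    split; [exact H3|]. constructor; [ord|]. eapply Forall_impl; [|exact He2].
    intros a Ha; cbn in Ha. ord.
Qed.

Lemma list_code_ex : exists lc : list K -> K, forall l l', lc l = lc l' -> l = l'.
Proof.
  destruct pairing_ex as (pr & Hpr1 & Hpr2). destruct zero_ex as [z Hz].
  exists (fun l => fold_right pr z l).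
  (* A pair code exceeds its first coordinate, so the least element [z] is free to code the empty
     list. *)
  assert (H : forall a b, pr a b <> z).
  { intros a b E. destruct (Hpr1 a b) as [H _]. specialize (Hz a). ord. }
  intros l. induction l as [|a l IH]; intros [|a' l'] E; cbn in *; auto.
  - destruct (H _ _ (eq_sym E)).
  - destruct (H _ _ E).
  - apply Hpr2 in E. destruct E as [-> E]. f_equal. auto.
Qed.

Lemma club_all : club (fun _ => True).
Proof.
  split; [|auto]. intros a. destruct (no_max a) as [b Hb]. eauto.
Qed.

(** Limits of [D] closed under [h] are found by an omega-iteration that picks points of [D] above
    all earlier values of [h]; the supremum of the sequence exists below kappa. *)
Lemma subclub (D : K -> Prop) (h : K -> K) : club D ->
  exists D', club D' /\ forall d, D' d ->
    D d /\ acc_pt D d /\ forall e, e << d -> h e << d.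
Proof.
  intros HD.
  exists (fun d => acc_pt D d /\ forall e, e << d -> h e << d).
  split.
  2:{ intros d [H1 H2]. split; [apply HD|]; auto. }
  split.
  - assert (Hs : forall a, exists b, D b /\ a << b /\ forall e, e <<= a -> h e << b).
    { intros a. destruct (tame_le a h) as [c Hc]. destruct (max2 a c) as (c' & H1 & H2).
      destruct (proj1 HD c') as (b & Hb & Hb'). exists b. repeat split; [exact Hb|ord|].
      intros e He. specialize (Hc e He). ord. }
    intros a. destruct (func_choice _ Hs) as [s Hs'].
    set (w := fun n => Nat.iter n s (s a)).
    assert (HDw : forall n, D (w n)) by (intros [|n]; cbn; apply Hs').
    destruct (sup_seq w) as (g & Hg & Hg'). { intros n. cbn. apply Hs'. }
    exists g. split; [split; [split|]|].
    + exists (w 0). apply Hg.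
    + intros b Hb. destruct (Hg' b Hb) as [n Hn]. exists (w n). auto.
    + intros e He. destruct (Hg' e He) as [n Hn]. specialize (Hg (S n)).
      cbn in Hg. destruct (Hs' (w n)) as (_ & _ & H).
      specialize (H e (lt_le _ _ Hn)). fold (w n) in Hg. ord.
    + specialize (Hg 0). cbn in Hg. pose proof (proj1 (proj2 (Hs' a))). ord.
  - intros g [H1 H2]. split; [split; [exact H1|]|].
    + intros b Hb. destruct (H2 b Hb) as (x & [Hx _] & Hbx & Hxg).
      exists x. split; [apply HD, Hx|auto].
    + intros e He. destruct (H2 e He) as (x & [_ Hx] & Hbx & Hxg).
      specialize (Hx e Hbx). ord.
Qed.

(** * Order types *)

(** The inner formula of [otp_lt], with the order type exposed. *)
Definition otp_is (A : K -> Prop) (b : K) : Prop :=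
  exists f : K -> K,
    (forall x, A x -> f x << b) /\
    (forall x y, A x -> A y -> x << y -> f x << f y) /\
    (forall g, g << b -> exists x, A x /\ f x = g).

(** By induction the collapse [f] lies pointwise below every increasing [g], so [f] cannot attain
    the value [b]. *)
Lemma otp_min A o (g : K -> K) b : otp_is A o ->
  (forall x y, A x -> A y -> x << y -> g x << g y) ->
  (forall x, A x -> g x << b) -> o <<= b.
Proof.
  intros (f & Hf1 & Hf2 & Hf3) Hg Hb.
  assert (H : forall x, A x -> f x <<= g x).
  { intros x. induction (lt_wf x) as [x _ IH]. intros Ax. apply not_lt. intros Hlt.
    destruct (Hf3 (g x)) as (y & Ay & Ey). { specialize (Hf1 x Ax). ord. }
    assert (Hyx : y << x).
    { apply not_le. intros [H|H]; [|subst; ord].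
      specialize (Hf2 x y Ax Ay H). ord. }
    specialize (IH y Hyx Ay). specialize (Hg y x Ay Ax Hyx). ord. }
  apply not_lt. intros Hlt. destruct (Hf3 b Hlt) as (x & Ax & Ex).
  specialize (H x Ax). specialize (Hb x Ax). ord.
Qed.

Lemma otp_is_ext A A' o : (forall x, A x <-> A' x) -> otp_is A o -> otp_is A' o.
Proof.
  intros H (f & H1 & H2 & H3). exists f. repeat split.
  - intros x Hx. apply H1, H, Hx.
  - intros x y Hx Hy. apply H2; apply H; assumption.
  - intros g Hg. destruct (H3 g Hg) as (x & Hx & E). exists x. split; [apply H, Hx|exact E].
Qed.

(** A point [y] of [A] at or above [x] would bound the order type of the initial segment by [f y],
    which is below [o]. *)
Lemma otp_initial A x o :
  otp_is A o -> otp_is (fun y => A y /\ y << x) o -> forall y, A y -> y << x.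
Proof.
  intros (f & Hf1 & Hf2 & _) Ho y Ay. apply not_le. intros Hxy.
  assert (H : o <<= f y).
  { apply (otp_min _ _ f _ Ho).
    - intros u v [Hu _] [Hv _]. auto.
    - intros u [Hu Hu']. apply Hf2; auto. ord. }
  specialize (Hf1 y Ay). ord.
Qed.

(** The transitive collapse, computed by [rank_ex]: its values form an initial segment and lie
    pointwise below [g]. *)
Lemma otp_of_embedding A (g : K -> K) b :
  (forall x y, A x -> A y -> x << y -> g x << g y) ->
  (forall x, A x -> g x << b) -> exists o, o <<= b /\ otp_is A o.
Proof.
  intros Hg Hb. destruct zero_ex as [z Hz].
  destruct (rank_ex (fun y x => A x /\ A y /\ y << x) (fun _ => z)) as [f Hf].
  { intros x. induction (lt_wf x) as [x _ IH]. constructor. intros y (_ & _ & Hy). auto. }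
  { intros x. apply tame_sub with (fun y => y << x); [apply tame_below|tauto]. }
  assert (Hlt : forall x y, A x -> A y -> x << y -> f x << f y).
  { intros x y Ax Ay H. apply (Hf y). auto. }
  assert (Hle : forall x, A x -> f x <<= g x).
  { intros x. induction (lt_wf x) as [x _ IH]. intros Ax. apply (Hf x); [apply Hz|].
    intros y (_ & Ay & Hy). specialize (IH y Hy Ay). specialize (Hg y x Ay Ax Hy). ord. }
  assert (Hon : forall k x, A x -> k <<= f x -> exists y, A y /\ f y = k).
  { intros k x. induction (lt_wf x) as [x _ IH]. intros Ax [H|H]; [|exists x; auto].
    destruct (classic (exists y, A y /\ y << x /\ k <<= f y)) as [(y & Ay & Hy & Hk)|HN];
      [exact (IH y Hy Ay Hk)|].
    assert (H' : f x <<= k); [|ord]. apply (Hf x); [apply Hz|].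
    intros y (_ & Ay & Hy). apply not_le. intros Hk. apply HN. eauto. }
  destruct (least (fun o => forall x, A x -> f x << o)) as (o & Ho & Hm).
  { exists b. intros x Ax. specialize (Hle x Ax). specialize (Hb x Ax). ord. }
  exists o. split.
  - apply Hm. intros x Ax. specialize (Hle x Ax). specialize (Hb x Ax). ord.
  - exists f. repeat split; auto. intros k Hk.
    assert (Hx : exists x, A x /\ k <<= f x).
    { apply NNPP. intros HN. assert (H : o <<= k); [|ord]. apply Hm.
      intros x Ax. apply not_le. intros H. apply HN. eauto. }
    destruct Hx as (x & Ax & Hx). eauto.
Qed.

Lemma otp_lt_of_embedding A (g : K -> K) b d : b << d ->
  (forall x y, A x -> A y -> x << y -> g x << g y) ->
  (forall x, A x -> g x << b) -> otp_lt K lt A d.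
Proof.
  intros Hd Hg Hb. destruct (otp_of_embedding A g b Hg Hb) as (o & Ho & H).
  exists o. split; [ord|exact H].
Qed.

(** * Trees with a level function *)

Section Trees.
Variables (T : Type) (ltT : T -> T -> Prop) (lev : T -> K).

(** One global level function replaces the rank maps that [on_level] quantifies separately at each
    node; [leveled_kappa_tree] and [kappa_tree_leveled] translate between the two forms. *)
Definition leveled : Prop :=
  (forall x y z, ltT x y -> ltT y z -> ltT x z) /\
  (forall x y, ltT y x -> lev y << lev x) /\
  (forall x e, e << lev x -> exists y, ltT y x /\ lev y = e) /\
  (forall x y z, ltT y x -> ltT z x -> lev y = lev z -> y = z) /\
  (forall a, exists x, lev x = a) /\
  (forall a, small (fun x => lev x = a)).

Definition hausdorff : Prop :=
  forall x y, lev x = lev y -> acc_kappa (lev x) -> (forall z, ltT z x -> ltT z y) -> x = y.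

(* Specialness, in regressive form on a club of levels. *)
Definition special_on (F : T -> K) (D : K -> Prop) : Prop :=
  club D /\
  (forall x, D (lev x) -> F x << lev x) /\
  (forall x y, D (lev x) -> D (lev y) -> F x = F y -> ~ ltT x y).

(** Composing the inverse of [f] with [g] gives an increasing map on the ordinals below [a], which
    therefore never drops below the identity. If [b << a], its value at [b] is at least [b],
    although [g] stays below [b]. *)
Lemma on_level_unique x a b :
  (forall y z, ltT y x -> ltT z x -> ltT y z \/ y = z \/ ltT z y) ->
  on_level K lt T ltT x a -> on_level K lt T ltT x b -> a <<= b.
Proof.
  intros lin (f & Hf1 & Hf2 & Hf3 & Hf4) (g & Hg1 & Hg2 & Hg3 & Hg4).
  apply not_lt. intros Hlt.
  destruct (func_choice_on x (fun e => e << a) (fun e y => ltT y x /\ f y = e)) as [h Hh];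
    [apply Hf4|].
  assert (H : forall e, e << a -> e <<= g (h e)).
  { intros e. induction (lt_wf e) as [e _ IH]. intros He. apply not_lt. intros Hge.
    destruct (Hh e He) as [H1 H2]. destruct (Hh (g (h e))) as [H3 H4]; [ord|].
    assert (H5 : g (h (g (h e))) << g (h e)).
    { apply Hg2; auto. destruct (lin _ _ H3 H1) as [H|[H|H]]; [exact H| |].
      - rewrite <- H in H2. ord.
      - apply Hf2 in H; auto. ord. }
    assert (H6 : g (h e) << a) by ord. specialize (IH (g (h e)) Hge H6). ord. }
  specialize (H b Hlt). destruct (Hh b Hlt) as [H1 _]. specialize (Hg1 _ H1). ord.
Qed.

Hypothesis HL : leveled.

Definition leT (y x : T) : Prop := ltT y x \/ y = x.

Lemma ltT_trans x y z : ltT x y -> ltT y z -> ltT x z.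
Proof. apply HL. Qed.

Lemma ltT_lev x y : ltT y x -> lev y << lev x.
Proof. apply HL. Qed.

Lemma leT_trans x y z : leT x y -> leT y z -> leT x z.
Proof. intros [H| ->] [H'| <-]; unfold leT; eauto using ltT_trans. Qed.

Lemma ltT_irr x : ~ ltT x x.
Proof. intros H. apply ltT_lev in H. ord. Qed.

Lemma leT_at x e : e <<= lev x -> exists y, leT y x /\ lev y = e.
Proof.
  intros [H| ->].
  - destruct (proj1 (proj2 (proj2 HL)) x e H) as (y & H1 & H2). exists y. split; [now left|auto].
  - exists x. split; [now right|reflexivity].
Qed.

Lemma leT_eq x y z : leT y x -> leT z x -> lev y = lev z -> y = z.
Proof.
  intros [H| ->] [H'| ->] E; auto.
  - apply (proj1 (proj2 (proj2 (proj2 HL))) x); auto.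
  - apply ltT_lev in H. ord.
  - apply ltT_lev in H'. ord.
Qed.

Lemma leT_of_lev x y z : leT y x -> leT z x -> lev y <<= lev z -> leT y z.
Proof.
  intros Hy Hz H. destruct (leT_at z (lev y) H) as (u & Hu & E).
  replace y with u; [exact Hu|]. apply (leT_eq x); auto. eapply leT_trans; eauto.
Qed.

Lemma ltT_of_lev x y z : leT y x -> leT z x -> lev y << lev z -> ltT y z.
Proof.
  intros Hy Hz H. destruct (leT_of_lev x y z Hy Hz) as [H'| ->]; auto; ord.
Qed.

Lemma level_ex a : exists x, lev x = a.
Proof. apply HL. Qed.

Lemma level_small a : small (fun x => lev x = a).
Proof. apply HL. Qed.

Lemma level_tame a : tame (fun x => lev x = a).
Proof. apply tame_of_small, level_small. Qed.

Lemma below_level_tame a : tame (fun x => lev x <<= a).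
Proof.
  apply tame_sub with (fun x => exists e, e <<= a /\ lev x = e).
  - apply tame_Union; [apply tame_le|]. intros e _. apply level_tame.
  - intros x Hx. eauto.
Qed.

Lemma on_level_lev x : on_level K lt T ltT x (lev x).
Proof.
  exists lev. split; [|split; [|split]].
  - intros y. apply ltT_lev.
  - intros y z _ _. apply ltT_lev.
  - intros y z Hy Hz. apply (leT_eq x); now left.
  - intros g Hg. exact (proj1 (proj2 (proj2 HL)) x g Hg).
Qed.

Lemma preds_linear x y z : ltT y x -> ltT z x -> ltT y z \/ y = z \/ ltT z y.
Proof.
  intros Hy Hz. assert (Hy' : leT y x) by now left. assert (Hz' : leT z x) by now left.
  destruct (lt_total (lev y) (lev z)) as [H|[H|H]].
  - left. now apply (ltT_of_lev x).
  - right; left. now apply (leT_eq x).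
  - right; right. now apply (ltT_of_lev x).
Qed.

Lemma on_level_iff x a : on_level K lt T ltT x a <-> lev x = a.
Proof.
  split.
  - intros H. pose proof (on_level_lev x) as H'.
    apply le_antisym; apply (on_level_unique x); auto; apply preds_linear.
  - intros <-. apply on_level_lev.
Qed.

Lemma leveled_kappa_tree : kappa_tree K lt T ltT.
Proof.
  repeat split.
  - apply ltT_irr.
  - apply ltT_trans.
  - apply preds_linear.
  - intros x. exists (lev x). apply on_level_lev.
  - intros a. destruct (level_ex a) as [x Hx]. exists x. now apply on_level_iff.
  - intros a. destruct (level_small a) as (b & f & Hf1 & Hf2). exists b, f. split.
    + intros x Hx. apply Hf1. now apply on_level_iff.
    + intros x y Hx Hy. apply Hf2; now apply on_level_iff.
Qed.

Lemma res_ex : exists res : T -> K -> T,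
  forall x e, e <<= lev x -> leT (res x e) x /\ lev (res x e) = e.
Proof.
  destruct (func_choice (fun (p : T * K) y => snd p <<= lev (fst p) ->
    leT y (fst p) /\ lev y = snd p)) as [r Hr].
  - intros [x e]; cbn. destruct (classic (e <<= lev x)) as [H|H].
    + destruct (leT_at x e H) as [y Hy]. exists y. auto.
    + exists x. tauto.
  - exists (fun x e => r (x, e)). intros x e. apply (Hr (x, e)).
Qed.

Lemma node_code_ex : exists cT : T -> K,
  (forall x, lev x << cT x) /\ (forall x y, cT x = cT y -> x = y).
Proof.
  destruct pairing_ex as (pr & Hpr1 & Hpr2).
  destruct (func_choice (fun a (i : T -> K) =>
    forall x y, lev x = a -> lev y = a -> i x = i y -> x = y)) as [i Hi].
  { intros a. destruct (level_small a) as (b & f & _ & Hf). eauto. }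
  exists (fun x => pr (lev x) (i (lev x) x)). split.
  - intros x. apply Hpr1.
  - intros x y E. apply Hpr2 in E. destruct E as [E1 E2].
    apply (Hi (lev x)); auto. rewrite E2. now rewrite E1.
Qed.

Section SpecialTree.
Variables (F : T -> K) (D : K -> Prop).
Hypothesis HS : special_on F D.

Lemma special_on_subclub D' : club D' -> (forall x, D' x -> D x) -> special_on F D'.
Proof.
  intros H1 H2. split; [exact H1|]. split.
  - intros x Hx. apply HS. auto.
  - intros x y Hx Hy. apply HS; auto.
Qed.

(** A chain of size kappa yields a branch [u] through all levels. Along [u], [F] is injective on
    [D], so [g e] can bound the points of [D] with value at most [e]; a point of [D] closed under
    [g] contradicts regressivity. *)
Lemma special_on_aronszajn : aronszajn K lt T ltT.
Proof.
  split; [apply leveled_kappa_tree|]. intros (B & f & HB & HBf & Hf).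
  destruct res_ex as [res Hres].
  assert (Hle : forall a b, leT (f a) (f b) \/ leT (f b) (f a)).
  { intros a b. unfold leT. destruct (HB (f a) (f b) (HBf a) (HBf b)) as [|[|]]; auto. }
  assert (Hinj : forall a b, lev (f a) = lev (f b) -> a = b).
  { intros a b E. apply Hf. destruct (Hle a b) as [H|H].
    - apply (leT_eq (f b)); [exact H|now right|exact E].
    - apply (leT_eq (f a)); [now right|exact H|exact E]. }
  assert (Hcof : forall d, exists a, d <<= lev (f a)).
  { intros d. apply NNPP. intros HN.
    assert (Hs : small (fun _ : K => True)).
    { exists d, (fun a => lev (f a)). split; [|auto]. intros a _. apply not_le.
      intros H. apply HN. eauto. }
    destruct (regular _ Hs) as [b Hb]. specialize (Hb b I). ord. }
  destruct (func_choice _ Hcof) as [c Hc].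
  set (u := fun d => res (f (c d)) d).
  assert (Hu : forall d, lev (u d) = d) by (intros d; apply Hres, Hc).
  assert (Hu' : forall d, leT (u d) (f (c d))) by (intros d; apply Hres, Hc).
  assert (Hlt : forall d d', d << d' -> ltT (u d) (u d')).
  { intros d d' Hd. assert (Hx : exists x, leT (u d) x /\ leT (u d') x).
    { destruct (Hle (c d) (c d')) as [H|H]; [exists (f (c d'))|exists (f (c d))];
        split; auto; (eapply leT_trans; [|exact H]); auto. }
    destruct Hx as (x & H1 & H2). apply (ltT_of_lev x); auto. now rewrite !Hu. }
  assert (HFinj : forall d d', D d -> D d' -> F (u d) = F (u d') -> d = d').
  { intros d d' Hd Hd' E.
    destruct (lt_total d d') as [H|[H|H]]; auto; exfalso; apply Hlt in H.
    - apply (proj2 (proj2 HS) (u d) (u d')); rewrite ?Hu; auto.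
    - apply (proj2 (proj2 HS) (u d') (u d)); rewrite ?Hu; auto. }
  destruct (func_choice (fun e b => forall d, D d -> F (u d) <<= e -> d << b)) as [g Hg].
  { intros e. destruct (no_max e) as [e' He'].
    destruct (regular (fun d => D d /\ F (u d) <<= e)) as [b Hb].
    - exists e', (fun d => F (u d)). split.
      + intros d [_ Hd]. ord.
      + intros d d' [Hd _] [Hd' _]. auto.
    - exists b. auto. }
  destruct (subclub D g (proj1 HS)) as (D' & HD' & HD'').
  destruct (zero_ex) as [z _]. destruct (proj1 HD' z) as (d & Hd & _).
  destruct (HD'' d Hd) as (Hd1 & _ & Hd2).
  assert (H : F (u d) << d) by (rewrite <- (Hu d) at 2; apply HS; now rewrite Hu).
  specialize (Hd2 _ H). specialize (Hg (F (u d)) d Hd1 (le_refl _)). ord.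
Qed.

(** A node on a level of [D'] drops to the level named by [F]. Any other non-minimal node drops only
    to level [m], at or above all earlier points of [D'], so that it cannot cross a point of
    [D']. *)
Lemma special_on_special : special K lt T ltT.
Proof.
  split; [apply leveled_kappa_tree|].
  destruct (subclub D (fun x => x) (proj1 HS)) as (D' & HD' & HD'D).
  assert (HS' := special_on_subclub D' HD' (fun x H => proj1 (HD'D x H))).
  destruct res_ex as [res Hres]. destruct zero_ex as [z0 Hz0].
  destruct (func_choice (fun e m => ~ D' e -> z0 << e -> m << e /\
    forall d, D' d -> d << e -> d <<= m)) as [m Hm].
  { intros e. apply NNPP. intros HN.
    assert (He : ~ D' e) by (intros H; apply HN; exists e; tauto).
    assert (He0 : z0 << e) by (apply NNPP; intros H; apply HN; exists e; tauto).
    apply He. apply HD'. split; [eauto|]. intros b Hb.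
    apply NNPP. intros HN'. apply HN. exists b. intros _ _. split; [exact Hb|].
    intros d Hd Hde. apply not_lt. intros Hbd. apply HN'. eauto. }
  set (f := fun x => if excluded_middle_informative (D' (lev x)) then res x (F x)
    else if excluded_middle_informative (z0 << lev x) then res x (m (lev x)) else x).
  exists f. split.
  - intros x [y Hy]. apply ltT_lev in Hy. pose proof (Hz0 (lev y)).
    assert (Hf : exists e, f x = res x e /\ e << lev x).
    { unfold f. destruct excluded_middle_informative as [HD|HD].
      - exists (F x). split; [reflexivity|]. now apply HS'.
      - destruct excluded_middle_informative as [Hz|Hz]; [|exfalso; ord].
        exists (m (lev x)). split; [reflexivity|]. now apply Hm. }
    destruct Hf as (e & -> & He). destruct (Hres x e (lt_le _ _ He)) as [[H1|H1] H2]; [exact H1|].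
    rewrite H1 in H2. ord.
  (* Index [d] carries the nodes on levels of [D'] with [F]-value [lev z]; an index [b << d] carries
     the whole level [b]. The remaining nodes of the fibre lie below level [d], since they do not
     cross it. *)
  - intros z. destruct (proj1 HD' (lev z)) as (d & Hd & Hzd). destruct (no_max d) as [a Ha].
    exists a, (fun b x => (b = d /\ D' (lev x) /\ F x = lev z) \/ (b << d /\ lev x = b)).
    split.
    + intros b Hb x y [(E' & Hx1 & Hx2)|[H1 Hx]] [(E & Hy1 & Hy2)|[H2 Hy]] Hxy; try (exfalso; ord).
      * split; apply HS'; auto; congruence.
      * split; intros H; apply ltT_lev in H; ord.
    + intros x Hx. unfold f in Hx. destruct excluded_middle_informative as [HD|HD].
      * exists d. split; [exact Ha|]. left. repeat split; auto.
        rewrite <- Hx. symmetry. apply Hres. left. now apply HS'.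
      * exists (lev x). assert (Hxd : lev x << d); [|split; [ord|right; auto]].
        apply not_le. intros [Hdx|Hdx]; [|congruence].
        destruct excluded_middle_informative as [Hz|Hz].
        -- destruct (Hm _ HD Hz) as [Hm1 Hm2]. specialize (Hm2 d Hd Hdx).
           destruct (Hres x (m (lev x)) (lt_le _ _ Hm1)) as [_ E]. rewrite Hx in E. ord.
        -- rewrite Hx in Hdx. ord.
Qed.

End SpecialTree.

End Trees.

(** * Translation of the abstract notions of tree and specialness *)

(** A map witnessing the level of [x], restricted to the predecessors of [y], witnesses level [f y]
    for [y]; uniqueness of levels then makes the local maps cohere. *)
Lemma kappa_tree_leveled (T : Type) (ltT : T -> T -> Prop) :
  kappa_tree K lt T ltT -> exists lev, leveled T ltT lev.
Proof.
  intros (irr & tr & lin & Hlev & Hex & Hsm).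
  destruct (func_choice _ Hlev) as [lev Hl]. exists lev.
  assert (uniq : forall x a, on_level K lt T ltT x a -> lev x = a).
  { intros x a H. apply le_antisym; apply (on_level_unique T ltT x); auto; apply lin. }
  assert (down : forall x f, (forall y, ltT y x -> f y << lev x) ->
     (forall y z, ltT y x -> ltT z x -> ltT y z -> f y << f z) ->
     (forall y z, ltT y x -> ltT z x -> f y = f z -> y = z) ->
     (forall g, g << lev x -> exists y, ltT y x /\ f y = g) ->
     forall y, ltT y x -> lev y = f y).
  { intros x f H1 H2 H3 H4 y Hy. apply uniq. exists f. split; [|split; [|split]].
    - intros u Hu. apply H2; eauto.
    - intros u v Hu Hv. apply H2; eauto.
    - intros u v Hu Hv. apply H3; eauto.
    - intros g Hg. destruct (H4 g) as (u & Hu & E). { specialize (H1 y Hy). ord. }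
      exists u. split; [|exact E]. destruct (lin x u y Hu Hy) as [H|[H|H]]; [exact H| |].
      + subst. ord.
      + apply H2 in H; auto. ord. }
  split; [exact tr|]. split; [|split; [|split; [|split]]].
  - intros x y Hy. destruct (Hl x) as (f & H1 & H2 & H3 & H4).
    rewrite (down x f H1 H2 H3 H4 y Hy). auto.
  - intros x e He. destruct (Hl x) as (f & H1 & H2 & H3 & H4).
    destruct (H4 e He) as (y & Hy & E). exists y. split; [exact Hy|].
    now rewrite (down x f H1 H2 H3 H4 y Hy).
  - intros x y z Hy Hz. destruct (Hl x) as (f & H1 & H2 & H3 & H4).
    rewrite (down x f H1 H2 H3 H4 y Hy), (down x f H1 H2 H3 H4 z Hz). auto.
  - intros a. destruct (Hex a) as [x Hx]. eauto.
  - intros a. destruct (Hsm a) as (b & f & H1 & H2). exists b, f. split.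
    + intros x Hx. apply H1. rewrite <- Hx. apply Hl.
    + intros x y Hx Hy. apply H2; [rewrite <- Hx|rewrite <- Hy]; apply Hl.
Qed.

(** [F] codes [f x] together with the index of an antichain of that fibre containing [x], so equal
    codes put two nodes into one antichain. Regressivity holds on levels closed under the bound [h]
    for such codes. *)
Lemma special_special_on (T : Type) (ltT : T -> T -> Prop) lev : leveled T ltT lev ->
  special K lt T ltT -> exists F D, special_on T ltT lev F D.
Proof.
  intros HL (_ & f & Hf & HA).
  destruct (node_code_ex T ltT lev HL) as (cT & _ & cT_inj).
  destruct pairing_ex as (pr & _ & pr_inj).
  destruct (func_choice _ HA) as [a Ha]. destruct (func_choice _ Ha) as [A HA'].
  destruct (func_choice (fun x b => b << a (f x) /\ A (f x) b x)) as [i Hi].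
  { intros x. apply HA'. reflexivity. }
  destruct (func_choice (fun e c => forall z b, lev z <<= e -> b << a z ->
     pr (cT z) b << c)) as [h Hh].
  { intros e.
    assert (Ht : tame (fun p => exists z, lev z <<= e /\ exists b, b << a z /\ p = (z, b))).
    { apply tame_Union; [eapply below_level_tame, HL|]. intros z _.
      apply tame_image, tame_below. }
    destruct (Ht (fun p => pr (cT (fst p)) (snd p))) as [c Hc]. exists c.
    intros z b Hz Hb. apply (Hc (z, b)). eauto. }
  destruct (subclub (fun _ => True) h club_all) as (D & HD & HD').
  assert (Hreg : forall x, D (lev x) -> ltT (f x) x).
  { intros x Hx. apply Hf. destruct (HD' _ Hx) as (_ & [[e He] _] & _).
    destruct (proj1 (proj2 (proj2 HL)) x e He) as (y & Hy & _). eauto. }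
  exists (fun x => pr (cT (f x)) (i x)), D. split; [exact HD|]. split.
  - intros x Hx. destruct (HD' _ Hx) as (_ & _ & H).
    assert (H1 : lev (f x) << lev x) by (apply HL, Hreg, Hx).
    specialize (H _ H1). specialize (Hh _ (f x) (i x) (le_refl _) (proj1 (Hi x))). ord.
  - intros x y Hx Hy E Hxy. apply pr_inj in E. destruct E as [E1 E2]. apply cT_inj in E1.
    destruct (Hi x) as [H1 H2], (Hi y) as [H3 H4]. rewrite <- E1, <- E2 in H4.
    destruct (proj1 (HA' (f x)) (i x) H1 x y H2 H4) as [H _]; [|auto].
    intros ->. apply HL in Hxy. ord.
Qed.

(** * From square sequences to special trees *)

Section Walks.
Variable C : K -> K -> Prop.
Hypothesis HC : C_sequence K lt C.

Lemma C_lt d x : C d x -> x << d.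
Proof. apply HC. Qed.

Lemma C_closed d g : g << d -> acc_pt (C d) g -> C d g.
Proof. apply HC. Qed.

(* [C 1] may be empty, hence the positivity assumption. *)
Lemma C_above z a b : z << a -> a << b -> exists c, C b c /\ a <<= c.
Proof.
  intros Hz Hab. apply NNPP. intros HN.
  assert (Hlt : forall c, C b c -> c << a).
  { intros c Hc. apply not_le. intros H. apply HN. eauto. }
  destruct (HC b) as (_ & _ & Hsup).
  assert (Hub : forall e, e << b -> e <<= a).
  { apply (proj1 (Hsup a)). intros c Hc. left. auto. }
  apply HN. exists a. split; [|apply le_refl]. apply C_closed; [exact Hab|].
  split; [eauto|]. intros e He. apply NNPP. intros HN'.
  assert (H : a <<= e); [|ord]. apply (proj1 (Hsup e)); [|exact Hab].
  intros c Hc. apply not_lt. intros H. apply HN'. exists c. auto.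
Qed.

(** The second alternative keeps the step total. For [e << b] it can occur only when [e] is the
    least ordinal, by [C_above], and the walk then jumps straight to [e]. *)
Definition step_spec (e b c : K) : Prop :=
  (C b c /\ e <<= c /\ forall c', C b c' -> e <<= c' -> c <<= c') \/
  ((forall c', C b c' -> c' << e) /\ c = e).

Lemma step_ex : exists nxt : K -> K -> K, forall e b, step_spec e b (nxt e b).
Proof.
  destruct (func_choice (fun (p : K * K) c => step_spec (fst p) (snd p) c)) as [n Hn].
  - intros [e b]; cbn. destruct (classic (exists c, C b c /\ e <<= c)) as [H|H].
    + destruct (least _ H) as (c & [H1 H2] & H3). exists c. left. repeat split; auto.
    + exists e. right. split; [|reflexivity]. intros c Hc. apply not_le. intros H'.
      apply H. eauto.
  - exists (fun e b => n (e, b)). intros e b. apply (Hn (e, b)).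
Qed.

Variable nxt : K -> K -> K.
Hypothesis Hnxt : forall e b, step_spec e b (nxt e b).

Lemma nxt_range e b : e << b -> e <<= nxt e b /\ nxt e b << b.
Proof.
  intros H. destruct (Hnxt e b) as [(H1 & H2 & _)|[_ ->]].
  - split; [exact H2|]. apply C_lt, H1.
  - split; [apply le_refl|exact H].
Qed.

Lemma nxt_eq e b e' b' z : z << e ->
  (forall c, C b c /\ e <<= c <-> C b' c /\ e' <<= c) ->
  e << b -> nxt e b = nxt e' b'.
Proof.
  intros Hz H Hb. destruct (C_above z e b Hz Hb) as (c & Hc1 & Hc2).
  destruct (Hnxt e b) as [(H1 & H2 & H3)|[H1 _]].
  2:{ specialize (H1 c Hc1). ord. }
  destruct (proj1 (H _) (conj H1 H2)) as [H1' H2'].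
  destruct (Hnxt e' b') as [(H4 & H5 & H6)|[H4 _]].
  2:{ specialize (H4 _ H1'). ord. }
  destruct (proj2 (H _) (conj H4 H5)) as [H4' H5'].
  apply le_antisym; auto.
Qed.

(* The walk from [b] down to [e] iterates [nxt e]; two walks are identified when they
   leave the same traces [C b] below [e], in place of equality of Todorcevic's rho_0. *)
Inductive same_walk (e : K) : K -> K -> Prop :=
| same_end : same_walk e e e
| same_step b b' : e << b -> e << b' ->
    (forall x, x << e -> (C b x <-> C b' x)) ->
    same_walk e (nxt e b) (nxt e b') -> same_walk e b b'.

Lemma same_walk_refl e b : e <<= b -> same_walk e b b.
Proof.
  induction (lt_wf b) as [b _ IH]. intros [H|<-]; [|constructor].
  destruct (nxt_range e b H) as [H1 H2]. constructor; auto. tauto.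
Qed.

Lemma same_walk_sym e b b' : same_walk e b b' -> same_walk e b' b.
Proof.
  induction 1; [constructor|]. constructor; auto. intros x Hx. symmetry. auto.
Qed.

Lemma same_walk_inv e b b' : same_walk e b b' -> e << b -> e << b' /\
  (forall x, x << e -> (C b x <-> C b' x)) /\ same_walk e (nxt e b) (nxt e b').
Proof. intros H Hb. destruct H; [ord|auto]. Qed.

Lemma same_walk_trans e b b' b'' : same_walk e b b' -> same_walk e b' b'' -> same_walk e b b''.
Proof.
  intros H. revert b''. induction H as [|b b' H1 H2 H3 H4 IH]; intros b'' H; [exact H|].
  destruct (same_walk_inv _ _ _ H H2) as (H5 & H6 & H7).
  constructor; auto. intros x Hx. rewrite H3, H6; tauto.
Qed.

Definition same_below (a b b' : K) : Prop := forall e, e << a -> same_walk e b b'.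

(* [l] lists a value for each point of the walk from [b] down to [a], except [a]. *)
Inductive walk (V : K -> K -> Prop) (a : K) : K -> list K -> Prop :=
| walk_end : walk V a a []
| walk_step b v l : a << b -> V b v -> walk V a (nxt a b) l -> walk V a b (v :: l).

Lemma walk_nil_inv V a b : walk V a b [] -> b = a.
Proof. now inversion 1. Qed.

Lemma walk_cons_inv V a b v l :
  walk V a b (v :: l) -> a << b /\ V b v /\ walk V a (nxt a b) l.
Proof. now inversion 1. Qed.

Lemma walk_ex V a : (forall b, a << b -> exists v, V b v) ->
  forall b, a <<= b -> exists l, walk V a b l.
Proof.
  intros HV b. induction (lt_wf b) as [b _ IH]. intros [H|<-].
  - destruct (nxt_range a b H) as [H1 H2]. destruct (IH _ H2 H1) as [l Hl].
    destruct (HV b H) as [v Hv]. exists (v :: l). now constructor.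
  - exists []. constructor.
Qed.

Lemma walk_Forall V a (P : K -> Prop) : (forall b v, a << b -> V b v -> P v) ->
  forall b l, walk V a b l -> Forall P l.
Proof. intros H b l Hl. induction Hl; constructor; eauto. Qed.

(** Equal code lists make the walks to [a] agree step by step; it has to be seen that they also
    control the walks to every smaller target. *)
Lemma walk_same (h : K -> K) a :
  (forall d d', h d = h d' -> forall x, (C d x /\ x << a) <-> (C d' x /\ x << a)) ->
  forall l b b', walk (fun b v => v = h b) a b l -> walk (fun b v => v = h b) a b' l ->
  same_below a b b'.
Proof.
  intros Hh l. induction l as [|v l IH]; intros b b' H H';
    [apply walk_nil_inv in H, H'; subst b b'
    |apply walk_cons_inv in H, H'; destruct H as (Hab & Hv & Hw), H' as (Hab' & Hv' & Hw')].
  - intros e He. apply same_walk_refl. ord.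
  - assert (HCC : forall x, x << a -> (C b x <-> C b' x)).
    { intros x Hx. specialize (Hh b b' ltac:(congruence) x). tauto. }
    intros e He. apply same_step; try ord.
    { intros x Hx. apply HCC. ord. }
    (* Either the common trace on [a] has a point at or above [e], and both walks step to the same
       ordinal, or the step toward [e] is the step toward [a]. *)
    destruct (classic (exists c, C b c /\ e <<= c /\ c << a)) as [(c & Hc1 & Hc2 & Hc3)|HN].
    + assert (E : nxt e b = nxt e b').
      { destruct (Hnxt e b) as [(H1 & H2 & H3)|[H1 _]]; [|specialize (H1 _ Hc1); ord].
        pose proof (H3 c Hc1 Hc2).
        assert (Hc1' : C b' c) by (apply HCC; auto).
        destruct (Hnxt e b') as [(H1' & H2' & H3')|[H1' _]]; [|specialize (H1' _ Hc1'); ord].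
        pose proof (H3' c Hc1' Hc2).
        apply le_antisym; [apply H3|apply H3']; auto; apply HCC; auto; ord. }
      rewrite E. apply same_walk_refl. apply nxt_range. ord.
    + assert (E : forall d, a << d -> (forall x, x << a -> (C b x <-> C d x)) ->
        nxt e d = nxt a d).
      { intros d Hd HCd. symmetry. apply (nxt_eq _ _ _ _ e); auto. intros c.
        split; intros [H1 H2]; split; auto; [ord|]. apply not_lt. intros H3.
        apply HN. exists c. split; [apply HCd|]; auto. }
      rewrite (E b), (E b'); auto; [|tauto]. eapply IH; eauto.
Qed.

(* [t] records the order type of [C d] when it is below [d]; it is needed because
   [d] may be a limit point of [C d']. *)
Lemma no_comparable_traces d d' t : acc_kappa d -> d << d' ->
  (forall a, d << a -> otp_lt K lt (inter K (C a) (below K lt d)) d) ->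
  (forall o, t = [o] -> otp_is (C d) o /\ otp_is (C d') o) ->
  (t = [] -> forall o, o << d -> ~ otp_is (C d) o) ->
  (t = [] \/ exists o, t = [o]) ->
  forall l b b',
  walk (fun b => otp_is (inter K (C b) (below K lt d))) d b l ->
  walk (fun b => otp_is (inter K (C b) (below K lt d'))) d' b' l ->
  forall e0, e0 << d -> (forall e, e0 << e -> e << d -> same_walk e b b') -> False.
Proof.
  intros Hd Hdd' HR Ht1 Ht2 Ht l.
  assert (agree : forall b b' e0, e0 << d -> d <<= b ->
    (forall e, e0 << e -> e << d -> same_walk e b b') ->
    forall x, x << d -> (C b x <-> C b' x)).
  { intros b b' e0 He0 Hb H x Hx. destruct (lim_gt2 d e0 x Hd He0 Hx) as (e & H1 & H2 & H3).
    destruct (same_walk_inv _ _ _ (H e H1 H3) ltac:(ord)) as (_ & H4 & _). auto. }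
  induction l as [|v l IH]; intros b b' H H' e0 He0 Hs;
    [apply walk_nil_inv in H, H'; subst b b'
    |apply walk_cons_inv in H, H'; destruct H as (Hab & Hv & Hw), H' as (Hab' & Hv' & Hw')].
  (* Both walks have ended, and [C d] is the trace of [C d'] on [d], of order type below [d]. So [t]
     is not empty, and the common order type leaves [C d'] no point at or above [d], against
     cofinality. *)
  - pose proof (agree d d' e0 He0 (le_refl _) Hs) as HA.
    assert (E : forall o, otp_is (C d) o <-> otp_is (inter K (C d') (below K lt d)) o).
    { intros o. split; apply otp_is_ext; intros x; split.
      - intros Hx. pose proof (C_lt _ _ Hx). split; [apply HA|]; auto.
      - intros [Hx1 Hx2]. apply HA; auto.
      - intros [Hx1 Hx2]. apply HA; auto.
      - intros Hx. pose proof (C_lt _ _ Hx). split; [apply HA|]; auto. }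
    destruct (HR d' Hdd') as (o & Ho & Hoo).
    destruct Ht as [->|[o' ->]].
    + apply (Ht2 eq_refl o Ho). apply E. exact Hoo.
    + destruct (Ht1 o' eq_refl) as [H1 H2]. apply E in H1.
      destruct (C_above e0 d d' He0 Hdd') as (c & Hc1 & Hc2).
      pose proof (otp_initial _ _ _ H2 H1 c Hc1). ord.
  - pose proof (agree b b' e0 He0 (lt_le _ _ Hab) Hs) as HA.
    (* The traces of [C b] on [d] and of [C b'] on [d'] agree below [d] and have equal order types,
       so the second has no further points. *)
    assert (Hno : forall c, C b' c -> c << d' -> c << d).
    { intros c Hc1 Hc2. apply (otp_initial _ d _ Hv'); [|split; auto].
      apply otp_is_ext with (2 := Hv). intros x. unfold inter, below. split.
      - intros [Hx1 Hx2]. repeat split; auto; [apply HA; auto|ord].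
      - intros [[Hx1 Hx2] Hx3]. split; auto. apply HA; auto. }
    (* Were [d] a limit of points of [C b], it would be one of [C b'] as well, hence a member of
       [C b'] below [d']. *)
    assert (Hbd : exists e1, e1 << d /\ forall c, C b c -> e1 << c -> d <<= c).
    { apply NNPP. intros HN. assert (Hacc : C b' d).
      { apply C_closed; [ord|]. split; [eauto|]. intros e He. apply NNPP. intros HN'.
        apply HN. exists e. split; [exact He|]. intros c Hc1 Hc2. apply not_lt. intros Hc3.
        apply HN'. exists c. split; [apply HA|]; auto. }
      specialize (Hno d Hacc Hdd'). ord. }
    destruct Hbd as (e1 & He1 & Hbd).
    destruct (lim_gt2 d e0 e1 Hd He0 He1) as (e2 & He2 & He2' & He2'').
    apply (IH _ _ Hw Hw' e2 He2''). intros e Hee Hed.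
    destruct (same_walk_inv _ _ _ (Hs e ltac:(ord) Hed) ltac:(ord)) as (_ & _ & Hs2).
    (* Past [e1], the step toward [e] is the step toward [d] from [b] and toward [d'] from [b'], so
       the induction hypothesis applies to the remaining walks. *)
    rewrite (nxt_eq d b e b e0), (nxt_eq d' b' e b' e0); auto; try ord.
    + intros c. split; intros [Hc1 Hc2]; split; auto; [ord|]. apply not_lt. intros Hc3.
      specialize (Hno c Hc1 Hc3). apply HA in Hc1; auto.
      assert (d <<= c); [apply Hbd; auto; ord|ord].
    + intros c. split; intros [Hc1 Hc2]; split; auto; [ord|]. apply Hbd; auto. ord.
Qed.

(** * The tree of classes of walks *)

Lemma same_below_refl a b : a <<= b -> same_below a b b.
Proof. intros H e He. apply same_walk_refl. ord. Qed.

Lemma same_below_sym a b b' : same_below a b b' -> same_below a b' b.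
Proof. intros H e He. apply same_walk_sym, H, He. Qed.

Lemma same_below_trans a b b' b'' :
  same_below a b b' -> same_below a b' b'' -> same_below a b b''.
Proof. intros H H' e He. eapply same_walk_trans; [apply H|apply H']; exact He. Qed.

Lemma same_below_le a a' b b' : a' <<= a -> same_below a b b' -> same_below a' b b'.
Proof. intros H H' e He. apply H'. ord. Qed.

(* A node on level [a] is the class of some [b >= a] under [same_below a],
   represented by its least element. *)
Definition node : Type := { p : K * K | fst p <<= snd p /\
  forall b, fst p <<= b -> same_below (fst p) b (snd p) -> snd p <<= b }.

Definition node_lev (x : node) : K := fst (proj1_sig x).
Definition node_top (x : node) : K := snd (proj1_sig x).
Definition node_lt (x y : node) : Prop :=
  node_lev x << node_lev y /\ same_below (node_lev x) (node_top x) (node_top y).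

Lemma node_le x : node_lev x <<= node_top x.
Proof. apply (proj2_sig x). Qed.

Lemma node_ex a b : a <<= b -> exists x, node_lev x = a /\ same_below a (node_top x) b.
Proof.
  intros Hab. destruct (least (fun c => a <<= c /\ same_below a c b)) as (c & [H1 H2] & H3).
  { exists b. split; [exact Hab|]. now apply same_below_refl. }
  assert (H : a <<= c /\ forall d, a <<= d -> same_below a d c -> c <<= d).
  { split; [exact H1|]. intros d Hd Hdc. apply H3. split; [exact Hd|].
    eapply same_below_trans; eauto. }
  exists (exist _ (a, c) H). now split.
Qed.

Lemma node_eq x y : node_lev x = node_lev y ->
  same_below (node_lev x) (node_top x) (node_top y) -> x = y.
Proof.
  destruct x as [[a b] [H1 H2]], y as [[a' b'] [H1' H2']]; unfold node_lev, node_top; cbn in *.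
  intros <- H. assert (E : b = b').
  { apply le_antisym; [apply H2|apply H2']; auto. now apply same_below_sym. }
  subst b'. f_equal. apply proof_irrelevance.
Qed.

(** [node_top] is injective on a level, so it suffices to bound it there. A node is determined by
    the list of codes along its walk, and such lists form a tame family. *)
Lemma node_small a : weakly_coherent K lt C -> small (fun x => node_lev x = a).
Proof.
  intros Hwc. destruct (Hwc a) as (a' & h & Hh1 & Hh2).
  set (V := fun b v => v = h b).
  assert (HV : forall b, a << b -> exists v, V b v) by (intros b _; now exists (h b)).
  destruct (func_choice_on a (fun l => exists x, node_lev x = a /\ walk V a (node_top x) l)
    (fun l b => exists x, node_lev x = a /\ walk V a (node_top x) l /\ node_top x = b))
    as [g Hg].
  { intros l (x & H1 & H2). eauto. }
  destruct (tame_lists _ (tame_below a') g) as [c Hc].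
  exists c, node_top. split.
  - intros x Hx. destruct (walk_ex V a HV (node_top x)) as [l Hl].
    { rewrite <- Hx. apply node_le. }
    destruct (Hg l) as (y & Hy1 & Hy2 & Hy3); [eauto|].
    replace x with y.
    + rewrite Hy3. apply Hc. apply walk_Forall with (2 := Hl). intros b v _ ->. auto.
    + apply node_eq; [congruence|]. rewrite Hy1. eapply walk_same; eauto.
  - intros x y Hx Hy E. apply node_eq; [congruence|]. rewrite E. apply same_below_refl.
    rewrite Hx, <- Hy. apply node_le.
Qed.

Lemma node_leveled : weakly_coherent K lt C -> leveled node node_lt node_lev.
Proof.
  intros Hwc. split; [|split; [|split; [|split; [|split]]]].
  - intros x y z [H1 H2] [H3 H4]. split; [ord|].
    eapply same_below_trans; [exact H2|]. eapply same_below_le; [|exact H4]. ord.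
  - intros x y [H _]. exact H.
  - intros x e He. pose proof (node_le x) as Hx.
    destruct (node_ex e (node_top x)) as (y & Hy1 & Hy2); [ord|].
    exists y. split; [|exact Hy1]. split; rewrite Hy1; assumption.
  - intros x y z [H1 H2] [H3 H4] E. apply node_eq; [exact E|].
    eapply same_below_trans; [exact H2|]. rewrite E. apply same_below_sym, H4.
  - intros a. destruct (node_ex a a (le_refl a)) as (x & Hx & _). eauto.
  - intros a. apply node_small, Hwc.
Qed.

(** Classes on level [a] compare walks to targets strictly below [a] only, so on a limit level they
    are determined by the classes below. *)
Lemma node_hausdorff : hausdorff node node_lt node_lev.
Proof.
  intros x y E Hlim H. apply node_eq; [exact E|]. intros e He.
  destruct (lim_gt _ e Hlim He) as (e' & H1 & H2).
  pose proof (node_le x) as Hx.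
  destruct (node_ex e' (node_top x)) as (z & Hz1 & Hz2); [ord|].
  assert (Hzx : node_lt z x) by (split; rewrite Hz1; assumption).
  destruct (H z Hzx) as [_ Hzy]. rewrite Hz1 in Hzy.
  eapply same_walk_trans; [apply same_walk_sym, Hz2|apply Hzy]; assumption.
Qed.

(** The finitely many order types coded at a node are below its limit level and have a common bound
    there; closure under [h] puts their code below the level too. Comparable nodes are told apart by
    [no_comparable_traces]. *)
Lemma node_special : contains_club K lt (R_set K lt C) ->
  exists F D, special_on node node_lt node_lev F D.
Proof.
  intros (E & HE & HER). destruct list_code_ex as [lc lc_inj].
  destruct pairing_ex as (pr & _ & pr_inj).
  destruct (func_choice (fun e c => forall l l', Forall (fun o => o <<= e) l ->
    Forall (fun o => o <<= e) l' -> pr (lc l) (lc l') << c)) as [h Hh].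
  { intros e. pose proof (tame_lists _ (tame_le e)) as Ht.
    destruct (tame_pair _ _ Ht Ht (fun p => pr (lc (fst p)) (lc (snd p)))) as [c Hc].
    exists c. intros l l' Hl Hl'. apply (Hc (l, l')). now split. }
  destruct (subclub E h HE) as (D & HD & HD').
  destruct (func_choice (fun d t => (exists o, t = [o] /\ o << d /\ otp_is (C d) o) \/
    (t = [] /\ forall o, o << d -> ~ otp_is (C d) o))) as [t Ht].
  { intros d. destruct (classic (exists o, o << d /\ otp_is (C d) o)) as [(o & H)|HN].
    - exists [o]. left. eauto.
    - exists []. right. split; [reflexivity|]. intros o H1 H2. apply HN. eauto. }
  set (V := fun d b o => o << d /\ otp_is (inter K (C b) (below K lt d)) o).
  destruct (func_choice (fun x l => D (node_lev x) ->
    walk (V (node_lev x)) (node_lev x) (node_top x) l)) as [l Hl].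
  { intros x. destruct (classic (D (node_lev x))) as [Hx|Hx]; [|exists []; tauto].
    destruct (walk_ex (V (node_lev x)) (node_lev x)) with (b := node_top x) as [l Hl].
    - intros b Hb. destruct (HER _ (proj1 (HD' _ Hx))) as [_ HR].
      destruct (HR b Hb) as (o & Ho). exists o. exact Ho.
    - apply node_le.
    - eauto. }
  exists (fun x => pr (lc (t (node_lev x))) (lc (l x))), D. split; [exact HD|]. split.
  - intros x Hx. destruct (HD' _ Hx) as (HEx & Hacc & Hcl). apply acc_pt_lim in Hacc.
    destruct (list_bound (node_lev x) (t (node_lev x) ++ l x) Hacc) as (e & He1 & He2).
    + apply Forall_app. split.
      * destruct (Ht (node_lev x)) as [(o & -> & Ho & _)|[-> _]]; auto.
      * eapply walk_Forall; [|apply (Hl x Hx)]. intros b v _ Hv. apply Hv.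
    + apply Forall_app in He2. specialize (Hcl e He1).
      pose proof (Hh e _ _ (proj1 He2) (proj2 He2)). ord.
  - intros x y Hx Hy Exy [Hlt Hsame]. apply pr_inj in Exy. destruct Exy as [E1 E2].
    apply lc_inj in E1, E2.
    destruct (HER _ (proj1 (HD' _ Hx))) as [Hlim HR].
    assert (Hw : forall d b l, walk (V d) d b l ->
      walk (fun b => otp_is (inter K (C b) (below K lt d))) d b l).
    { intros d b l0 H. induction H; constructor; auto. apply H0. }
    destruct (proj1 Hlim) as [e0 He0].
    apply (no_comparable_traces (node_lev x) (node_lev y) (t (node_lev x)) Hlim Hlt HR)
      with (l := l x) (b := node_top x) (b' := node_top y) (e0 := e0); auto.
    + intros o Eo. split.
      * destruct (Ht (node_lev x)) as [(o' & Eo' & _ & H)|[Eo' _]]; congruence.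
      * destruct (Ht (node_lev y)) as [(o' & Eo' & _ & H)|[Eo' _]]; congruence.
    + intros Eo. destruct (Ht (node_lev x)) as [(o' & Eo' & _ & H)|[_ H]]; [congruence|exact H].
    + destruct (Ht (node_lev x)) as [(o' & Eo' & _)|[Eo' _]]; eauto.
    + rewrite E2. auto.
Qed.

End Walks.

Lemma square_lt_tree : square_lt K lt ->
  exists (T : Type) (ltT : T -> T -> Prop) lev F D,
    leveled T ltT lev /\ special_on T ltT lev F D /\ hausdorff T ltT lev.
Proof.
  intros (C & HC & Hwc & HR). destruct (step_ex C) as [nxt Hnxt].
  destruct (node_special C HC nxt Hnxt HR) as (F & D & HF).
  exists (node C nxt), (node_lt C nxt), (node_lev C nxt), F, D.
  split; [apply node_leveled|split; [|apply node_hausdorff]]; auto.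
Qed.

(** * From special trees to square sequences *)

Lemma acc_pt_ext (A A' : K -> Prop) g : (forall x, A x <-> A' x) -> acc_pt A g -> acc_pt A' g.
Proof.
  intros H [H1 H2]. split; [exact H1|]. intros b Hb.
  destruct (H2 b Hb) as (x & Hx & H3). exists x. split; [apply H, Hx|exact H3].
Qed.

Lemma seq_split (s : nat -> K) g n : g <<= s n ->
  g <<= s 0 \/ exists N, s N << g /\ g <<= s (S N).
Proof.
  induction n as [|n IH]; [auto|]. intros Hn.
  destruct (classic (s n << g)) as [H|H]; [eauto|]. apply IH. now apply not_lt.
Qed.

(* Fewer than kappa many [Q]-classes meet [S]. *)
Definition few (S : K -> Prop) (Q : K -> K -> Prop) : Prop :=
  exists (h : K -> K) (a : K), (forall d, S d -> h d << a) /\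
    forall d d', S d -> S d' -> h d = h d' -> Q d d'.

(** Each [d] is labelled by a representative with the same code; tameness of the set of codes bounds
    the representatives. *)
Lemma few_of_code {X : Type} (P : X -> Prop) (R : K -> X -> Prop) S (Q : K -> K -> Prop) :
  tame P -> (forall d, S d -> exists x, P x /\ R d x) ->
  (forall d d' x, R d x -> R d' x -> Q d d') -> few S Q.
Proof.
  intros HP HR HQ. destruct zero_ex as [z _].
  destruct (classic (exists d, S d)) as [[d0 Hd0]|HN].
  2:{ exists (fun d => d), z. split; [intros d Hd|intros d d' Hd]; destruct HN; eauto. }
  destruct (HR d0 Hd0) as [x0 _].
  destruct (func_choice_on x0 S (fun d x => P x /\ R d x)) as [c Hc]; [exact HR|].
  destruct (func_choice_on z (fun x => exists d, S d /\ c d = x) (fun x d => c d = x))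
    as [g Hg].
  { intros x (d & _ & Hd). eauto. }
  destruct (HP g) as [a Ha]. exists (fun d => g (c d)), a. split.
  - intros d Hd. apply Ha, Hc, Hd.
  - intros d d' Hd Hd' E. apply (HQ d d' (c d)); [apply Hc, Hd|].
    rewrite <- (Hg (c d)) by eauto. rewrite E. rewrite (Hg (c d')) by eauto. apply Hc, Hd'.
Qed.

Lemma few_or S S1 S2 Q : (forall d, S d -> S1 d \/ S2 d) -> few S1 Q -> few S2 Q -> few S Q.
Proof.
  intros H (h1 & a1 & H1 & H1') (h2 & a2 & H2 & H2').
  apply (few_of_code (fun x : K + K => match x with inl x => x << a1 | inr x => x << a2 end)
    (fun d x => match x with inl x => S1 d /\ x = h1 d | inr x => S2 d /\ x = h2 d end)).
  - intros g. destruct (tame_below a1 (fun x => g (inl x))) as [b1 Hb1].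
    destruct (tame_below a2 (fun x => g (inr x))) as [b2 Hb2].
    destruct (max2 b1 b2) as (b & Hb1' & Hb2'). exists b.
    intros [x|x] Hx; [specialize (Hb1 x Hx)|specialize (Hb2 x Hx)]; cbn in *; ord.
  - intros d Hd. destruct (H d Hd) as [Hd'|Hd']; [exists (inl (h1 d))|exists (inr (h2 d))]; auto.
  - intros d d' [x|x] [Hd ->] [Hd' E]; auto.
Qed.

(** * The C-sequence of a special tree *)

Section FromTree.
Variables (T : Type) (ltT : T -> T -> Prop) (lev : T -> K) (F : T -> K) (D : K -> Prop)
  (res : T -> K -> T) (cod : T -> K -> K) (t : K -> T) (m : K -> K -> K) (sA : K -> nat -> K).
Hypothesis HL : leveled T ltT lev.
Hypothesis HS : special_on T ltT lev F D.
Hypothesis D_lim : forall d, D d -> acc_kappa d.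
Hypothesis Hres : forall x e, e <<= lev x -> leT T ltT (res x e) x /\ lev (res x e) = e.
Hypothesis cod_inj : forall y v y' v', cod y v = cod y' v' -> y = y' /\ v = v'.
Hypothesis cod_gt : forall y v, lev y << cod y v.
Hypothesis cod_lt : forall y v d, D d -> lev y << d -> v << d -> cod y v << d.
Hypothesis Ht : forall d, lev (t d) = d.

Let P (d e : K) : T := res (t d) e.

Hypothesis Hm : forall d e, D e -> e << d ->
  (exists e', D e' /\ e <<= e' /\ e' << d /\ m d e = F (P d e')) /\
  forall e', D e' -> e <<= e' -> e' << d -> m d e <<= F (P d e').

Definition cof_seq (d : K) (s : nat -> K) : Prop :=
  (forall n, D (s n) /\ s n << s (S n) /\ s n << d) /\
  forall b, b << d -> exists n, b << s n.
(** For a limit point [d] of [D] this means that [d] has cofinality omega. *)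
Definition cof (d : K) : Prop := exists s, cof_seq d s.

Hypothesis HsA : forall d, cof d -> cof_seq d (sA d).

(* The left endpoints of the intervals of [D] on which [m d] is constant, so that [m d]
   is strictly increasing on [B d]. *)
Definition B (d e : K) : Prop :=
  D e /\ e << d /\ F (t d) << e /\ forall e', D e' -> e' << e -> m d e' << m d e.
(* Non-limit points of [B d] are moved off [D], to a code of the branch so far and of
   [F (t d)]: distinct comparable nodes have distinct values of [F], hence no common code. *)
Definition pt (d e c : K) : Prop :=
  (acc_pt (B d) e /\ c = e) \/ (~ acc_pt (B d) e /\ c = cod (P d e) (F (t d))).
Definition CB (d c : K) : Prop := exists e, B d e /\ pt d e c.
Definition CA (d c : K) : Prop := exists n, c = sA d n.

(** When [d] is not a limit of [D], a tail of [d] above all earlier points of [D] is taken: it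
    leaves nothing below those points, and its traces are again tails. *)
Definition Ct (d c : K) : Prop := c << d /\
  (~ acc_pt D d /\ (forall e, D e -> e << d -> e <<= c) \/
   acc_pt D d /\ cof d /\ CA d c \/
   acc_pt D d /\ ~ cof d /\ CB d c).

Lemma D_closed d : acc_pt D d -> D d.
Proof. apply HS. Qed.

Lemma D_next e : exists e', D e' /\ e << e'.
Proof. apply HS. Qed.

Lemma P_lev d e : e <<= d -> lev (P d e) = e.
Proof. intros H. apply Hres. now rewrite Ht. Qed.

Lemma P_le d e : e <<= d -> leT T ltT (P d e) (t d).
Proof. intros H. apply Hres. now rewrite Ht. Qed.

Lemma P_lt d e e' : e << e' -> e' <<= d -> ltT (P d e) (P d e').
Proof.
  intros H H'. apply (ltT_of_lev T ltT lev HL (t d)); try apply P_le; try ord.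
  rewrite !P_lev; ord.
Qed.

Lemma P_self d : P d d = t d.
Proof.
  apply (leT_eq T ltT lev HL (t d)); [apply P_le, le_refl|now right|].
  now rewrite Ht, P_lev by apply le_refl.
Qed.

Lemma P_coh d d' e e' : e <<= d -> e <<= d' -> P d e = P d' e -> e' <<= e -> P d e' = P d' e'.
Proof.
  intros H H' E He. apply (leT_eq T ltT lev HL (t d)).
  - apply P_le; ord.
  - apply (leT_trans T ltT lev HL _ (P d e)); [|now apply P_le]. rewrite E.
    apply (leT_of_lev T ltT lev HL (t d')); try apply P_le; try ord.
    rewrite !P_lev; ord.
  - rewrite !P_lev; ord.
Qed.

Lemma F_P_lt d e : D e -> e <<= d -> F (P d e) << e.
Proof.
  intros He Hed. rewrite <- (P_lev d e Hed) at 2. apply HS. now rewrite P_lev.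
Qed.

Lemma F_P_neq d e e' : D e -> D e' -> e << e' -> e' <<= d -> F (P d e) <> F (P d e').
Proof.
  intros He He' H Hd E. apply (proj2 (proj2 HS) (P d e) (P d e')); auto.
  - rewrite P_lev; auto; ord.
  - rewrite P_lev; auto.
  - now apply P_lt.
Qed.

Lemma m_le d e : D e -> e << d -> m d e <<= F (P d e).
Proof. intros He H. apply (Hm d e He H); auto. apply le_refl. Qed.

Lemma m_lt d e : D e -> e << d -> m d e << e.
Proof.
  intros He H. pose proof (m_le d e He H). pose proof (F_P_lt d e He (lt_le _ _ H)). ord.
Qed.

Lemma m_mono d e e' : D e -> D e' -> e <<= e' -> e' << d -> m d e <<= m d e'.
Proof.
  intros He He' H Hd. destruct (proj1 (Hm d e' He' Hd)) as (e1 & H1 & H2 & H3 & ->).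
  apply (Hm d e He); auto; ord.
Qed.

(** Past a point where the minimum [m d d0] is attained, [m d] must be larger, because [F] does not
    repeat along a branch. The first point of [D] with a larger value belongs to [B d]. *)
Lemma B_cofinal d b : acc_pt D d -> b << d -> exists e, B d e /\ b << e.
Proof.
  intros Hd Hb. pose proof (D_closed d Hd) as HDd.
  assert (HF : F (t d) << d) by (rewrite <- P_self; apply F_P_lt; [exact HDd|apply le_refl]).
  destruct (lim_gt2 d b (F (t d)) (acc_pt_lim _ _ Hd) Hb HF) as (b' & H1 & H2 & H3).
  destruct (proj2 Hd b' H3) as (d0 & Hd0 & Hbd0 & Hd0d).
  destruct (proj1 (Hm d d0 Hd0 Hd0d)) as (e0 & He0 & Hde0 & He0d & Em).
  destruct (proj2 Hd e0 He0d) as (e1 & He1 & He01 & He1d).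
  destruct (least (fun e => D e /\ e << d /\ m d d0 << m d e)) as (e & (He & Hed & Hme) & Hl).
  { exists e1. repeat split; auto.
    destruct (proj1 (Hm d e1 He1 He1d)) as (e2 & He2 & He12 & He2d & Em').
    destruct (m_mono d d0 e1) as [H|H]; auto; [ord|].
    exfalso. apply (F_P_neq d e0 e2); auto; try ord.  }
  assert (Hlt : d0 << e).
  { apply not_le. intros H. pose proof (m_mono d e d0 He Hd0 H Hd0d). ord. }
  exists e. split; [|ord]. split; [exact He|]. split; [exact Hed|]. split; [ord|].
  intros e' He' Hlt'. assert (~ m d d0 << m d e').
  { intros H. assert (e <<= e') by (apply Hl; repeat split; auto; ord). ord. }
  ord.
Qed.

Lemma B_closed d g : g << d -> acc_pt (B d) g -> B d g.
Proof.
  intros Hg Hacc.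
  assert (HDg : D g).
  { apply D_closed. split; [apply Hacc|]. intros b Hb.
    destruct (proj2 Hacc b Hb) as (x & [Hx _] & H). eauto. }
  split; [exact HDg|]. split; [exact Hg|]. split.
  - destruct (proj1 Hacc) as [b Hb]. destruct (proj2 Hacc b Hb) as (x & Hx & _ & Hxg).
    destruct Hx as (_ & _ & Hx & _). ord.
  - intros e' He' Hlt. destruct (proj2 Hacc e' Hlt) as (x & Hx & Hex & Hxg).
    pose proof (proj2 (proj2 (proj2 Hx)) e' He' Hex).
    pose proof (m_mono d x g (proj1 Hx) HDg (lt_le _ _ Hxg) Hg). ord.
Qed.

Lemma pt_ex d e : exists c, pt d e c.
Proof. unfold pt. destruct (classic (acc_pt (B d) e)); eauto. Qed.

(** Points of [D] are closed under [cod], so moving a point never crosses the next point of [D].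
    This is why [CB d] inherits the order and the limit points of [B d]. *)
Lemma pt_range d e c : B d e -> pt d e c -> e <<= c /\ forall d', D d' -> e << d' -> c << d'.
Proof.
  intros (He & Hed & HF & _) [[_ ->]|[_ ->]].
  - split; [apply le_refl|auto].
  - pose proof (P_lev d e (lt_le _ _ Hed)) as El.
    pose proof (cod_gt (P d e) (F (t d))). split; [ord|].
    intros d' Hd' H'. apply cod_lt; auto; ord.
Qed.

Lemma pt_mono d e c e' c' : B d e -> pt d e c -> B d e' -> pt d e' c' -> c << c' -> e << e'.
Proof.
  intros He Hc He' Hc' Hlt. apply not_le. intros [H|H].
  - pose proof (proj2 (pt_range _ _ _ He' Hc') e (proj1 He) H).
    pose proof (proj1 (pt_range _ _ _ He Hc)). ord.
  - subst e'. destruct Hc as [[H1 ->]|[H1 ->]], Hc' as [[H2 ->]|[H2 ->]];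
      solve [ord|contradiction].
Qed.

Lemma CB_acc d g : acc_pt (CB d) g <-> acc_pt (B d) g.
Proof.
  split; intros [H1 H2]; (split; [exact H1|]); intros b Hb.
  (* Two points of [CB d] are needed: the source [e1] may fail to exceed [b], whereas [e2] lies
     above [c1]. *)
  - destruct (H2 b Hb) as (c1 & (e1 & He1 & Hc1) & Hbc1 & Hc1g).
    destruct (H2 c1 Hc1g) as (c2 & (e2 & He2 & Hc2) & Hc12 & Hc2g).
    pose proof (pt_mono _ _ _ _ _ He1 Hc1 He2 Hc2 Hc12) as H.
    pose proof (proj2 (pt_range _ _ _ He1 Hc1) e2 (proj1 He2) H).
    pose proof (proj1 (pt_range _ _ _ He2 Hc2)).
    exists e2. split; [exact He2|]. split; ord.
  - destruct (H2 b Hb) as (e1 & He1 & Hbe1 & He1g).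
    destruct (H2 e1 He1g) as (e2 & He2 & He12 & He2g).
    destruct (pt_ex d e1) as [c Hc]. destruct (pt_range _ _ _ He1 Hc) as [H3 H4].
    specialize (H4 e2 (proj1 He2) He12).
    exists c. split; [exists e1; auto|]. split; ord.
Qed.

Lemma CB_closed d g : g << d -> acc_pt (CB d) g -> CB d g.
Proof.
  intros Hg Hacc. apply CB_acc in Hacc. exists g. split; [now apply B_closed|]. now left.
Qed.

Lemma CB_cofinal d b : acc_pt D d -> b << d -> exists c, CB d c /\ b << c.
Proof.
  intros Hd Hb. destruct (B_cofinal d b Hd Hb) as (e & He & Hbe).
  destruct (pt_ex d e) as [c Hc]. pose proof (proj1 (pt_range _ _ _ He Hc)).
  exists c. split; [exists e; auto|ord].
Qed.

Lemma CB_lt d c : D d -> CB d c -> c << d.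
Proof. intros Hd (e & He & Hc). apply (pt_range _ _ _ He Hc); auto. apply He. Qed.

Lemma CB_otp_lt d A v b : v << b -> acc_kappa b ->
  (forall c, A c -> exists e, B d e /\ pt d e c /\ m d e <<= v) -> otp_lt K lt A b.
Proof.
  intros Hvb Hb HA.
  destruct (func_choice_on b A (fun c w => exists e, B d e /\ pt d e c /\ m d e <<= v /\ w = m d e))
    as [g Hg].
  { intros c Hc. destruct (HA c Hc) as (e & H1 & H2 & H3). eauto 6. }
  destruct (lim_gt b v Hb Hvb) as (b' & Hb1 & Hb2).
  apply (otp_lt_of_embedding A g b' b Hb2).
  - intros x y Ax Ay Hxy. destruct (Hg x Ax) as (e & H1 & H2 & _ & ->).
    destruct (Hg y Ay) as (e' & H3 & H4 & _ & ->).
    apply H3; [apply H1|]. exact (pt_mono _ _ _ _ _ H1 H2 H3 H4 Hxy).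
  - intros x Ax. destruct (Hg x Ax) as (e & _ & _ & H & ->). ord.
Qed.

Lemma CB_otp_initial a d : D d -> d << a -> otp_lt K lt (inter K (CB a) (below K lt d)) d.
Proof.
  intros Hd Hda. apply (CB_otp_lt a _ (m a d)).
  - now apply m_lt.
  - now apply D_lim.
  - intros c [(e & He & Hc) Hcd]. exists e. split; [exact He|]. split; [exact Hc|].
    pose proof (proj1 (pt_range _ _ _ He Hc)). unfold below in Hcd.
    apply m_mono; auto; [apply He|ord].
Qed.

(* If [m d] were unbounded on [B d], a sequence through [B d] with
   [s n << m d (s (n+1))] would converge to some [g << d] in [D] with [m d g << g],
   contradicting monotonicity of [m d]. *)
Lemma CB_otp d : acc_pt D d -> ~ cof d -> otp_lt K lt (CB d) d.
Proof.
  intros Hd Hcof.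
  assert (Hb : exists v, v << d /\ forall e, B d e -> m d e <<= v).
  { apply NNPP. intros HN.
    assert (Hn : forall b, b << d -> exists e, B d e /\ b << m d e).
    { intros b Hb. apply NNPP. intros H. apply HN. exists b. split; [exact Hb|].
      intros e He. apply not_lt. intros Hbe. apply H. eauto. }
    destruct (proj1 Hd) as [b0 Hb0]. destruct (Hn b0 Hb0) as (e0 & He0 & _).
    destruct (func_choice_on e0 (fun b => b << d) (fun b e => B d e /\ b << m d e)) as [s Hs];
      [exact Hn|].
    set (w := fun n => Nat.iter n s e0).
    assert (HB : forall n, B d (w n)).
    { intros n. induction n as [|n IH]; cbn; [exact He0|]. apply Hs, IH. }
    assert (Hw : forall n, w n << m d (w (S n))).
    { intros n. apply (Hs (w n)). apply HB. }
    assert (Hw' : forall n, w n << w (S n)).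
    { intros n. specialize (Hw n).
      pose proof (m_lt d (w (S n)) (proj1 (HB (S n))) (proj1 (proj2 (HB (S n))))). ord. }
    destruct (sup_seq w Hw') as (g & Hg1 & Hg2).
    destruct (classic (g << d)) as [Hgd|Hgd].
    - assert (HDg : D g).
      { apply D_closed. split; [exists (w 0); auto|]. intros b Hbg.
        destruct (Hg2 b Hbg) as [n Hn']. exists (w n). split; [apply HB|auto]. }
      destruct (Hg2 _ (m_lt d g HDg Hgd)) as [n Hn'].
      pose proof (m_mono d (w (S n)) g (proj1 (HB _)) HDg (lt_le _ _ (Hg1 _)) Hgd).
      specialize (Hw n). ord.
    - apply Hcof. exists w. split.
      + intros n. split; [apply HB|]. split; [apply Hw'|apply HB].
      + intros b Hb. apply Hg2. ord. }
  destruct Hb as (v & Hv & Hb). apply (CB_otp_lt d _ v); auto.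
  - eapply acc_pt_lim, Hd.
  - intros c (e & He & Hc). eauto.
Qed.

Lemma CA_lt d c : cof d -> CA d c -> c << d.
Proof. intros Hd [n ->]. apply (HsA d Hd). Qed.

Lemma CA_D d c : cof d -> CA d c -> D c.
Proof. intros Hd [n ->]. apply (HsA d Hd). Qed.

Lemma CA_bounded d g z : cof d -> z << g -> g << d ->
  exists b, b << g /\ forall x, CA d x -> x << g -> x <<= b.
Proof.
  intros Hd Hz Hg. destruct (HsA d Hd) as [Hs1 Hs2]. destruct (Hs2 g Hg) as [n Hn].
  assert (Hs : forall n, sA d n << sA d (S n)) by apply Hs1.
  destruct (seq_split (sA d) g n (lt_le _ _ Hn)) as [H|(N & H1 & H2)].
  - exists z. split; [exact Hz|]. intros x [k ->] Hx.
    pose proof (seq_le _ 0 k Hs (le_0_n k)). ord.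
  - exists (sA d N). split; [exact H1|]. intros x [k ->] Hx.
    destruct (Compare_dec.le_lt_dec k N) as [H|H]; [now apply seq_le|].
    pose proof (seq_le _ (S N) k Hs H). ord.
Qed.

Lemma CA_not_acc d g : cof d -> g << d -> ~ acc_pt (CA d) g.
Proof.
  intros Hd Hg [[z Hz] Hacc]. destruct (CA_bounded d g z Hd Hz Hg) as (b & Hb1 & Hb2).
  destruct (Hacc b Hb1) as (x & Hx & Hbx & Hxg). specialize (Hb2 x Hx Hxg). ord.
Qed.

(** A point [e0] of [D] below [e] is itself a limit, hence contains an increasing omega-sequence
    [w]; sending [sA d n] to [w n] embeds [A] below [e0]. *)
Lemma CA_otp d A e : (forall x, A x -> CA d x) -> cof d -> acc_pt D e -> otp_lt K lt A e.
Proof.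
  intros HA Hd He. destruct (HsA d Hd) as [Hs1 _].
  assert (Hs : forall n, sA d n << sA d (S n)) by apply Hs1.
  destruct (proj1 He) as [b0 Hb0]. destruct (proj2 He b0 Hb0) as (e0 & He0 & _ & Hlt).
  destruct (proj1 (D_lim _ He0)) as [z Hz].
  destruct (func_choice_on z (fun b => b << e0) (fun b c => b << c /\ c << e0)) as [u Hu].
  { intros b Hb. apply lim_gt; auto. }
  set (w := fun n => Nat.iter n u z).
  assert (Hw : forall n, w n << e0).
  { intros n. induction n as [|n IH]; cbn; [exact Hz|]. apply Hu, IH. }
  assert (Hw' : forall n, w n << w (S n)) by (intros n; apply (Hu (w n)), Hw).
  destruct (func_choice_on z A (fun x c => exists n, x = sA d n /\ c = w n)) as [g Hg].
  { intros x Hx. destruct (HA x Hx) as [n ->]. eauto. }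
  apply (otp_lt_of_embedding A g e0 e Hlt).
  - intros x y Ax Ay Hxy. destruct (Hg x Ax) as (n & -> & ->), (Hg y Ay) as (k & -> & ->).
    destruct (Compare_dec.le_lt_dec k n) as [H|H].
    + pose proof (seq_le _ k n Hs H). ord.
    + pose proof (seq_le w (S n) k Hw' H). specialize (Hw' n). ord.
  - intros x Ax. destruct (Hg x Ax) as (n & _ & ->). apply Hw.
Qed.

Lemma Ct_N d x : ~ acc_pt D d ->
  (Ct d x <-> x << d /\ forall e, D e -> e << d -> e <<= x).
Proof. unfold Ct. tauto. Qed.

Lemma Ct_A d x : acc_pt D d -> cof d -> (Ct d x <-> CA d x).
Proof. intros Hd Hc. unfold Ct. pose proof (CA_lt d x Hc). tauto. Qed.

Lemma Ct_B d x : acc_pt D d -> ~ cof d -> (Ct d x <-> CB d x).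
Proof. intros Hd Hc. unfold Ct. pose proof (CB_lt d x (D_closed d Hd)). tauto. Qed.

Lemma Ct_cases d : ~ acc_pt D d \/ (acc_pt D d /\ cof d) \/ (acc_pt D d /\ ~ cof d).
Proof. tauto. Qed.

Lemma Ct_cofinal d x : x << d -> exists c, Ct d c /\ x <<= c.
Proof.
  intros Hx. destruct (Ct_cases d) as [Hd|[[Hd Hc]|[Hd Hc]]].
  - assert (Hb : exists b, b << d /\ forall e, D e -> e << d -> e <<= b).
    { apply NNPP. intros HN. apply Hd. split; [eauto|]. intros b Hb. apply NNPP. intros HN'.
      apply HN. exists b. split; [exact Hb|]. intros e He Hed. apply not_lt. intros Hbe.
      apply HN'. eauto. }
    destruct Hb as (b & Hb1 & Hb2). destruct (classic (b << x)) as [H|H].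
    + exists x. split; [|apply le_refl]. apply Ct_N; auto. split; [exact Hx|].
      intros e He Hed. specialize (Hb2 e He Hed). ord.
    + exists b. split; [|ord]. apply Ct_N; auto.
  - destruct (HsA d Hc) as [_ H]. destruct (H x Hx) as [n Hn].
    exists (sA d n). split; [|ord]. apply Ct_A; auto. now exists n.
  - destruct (CB_cofinal d x Hd Hx) as (c & H1 & H2). exists c. split; [|ord]. now apply Ct_B.
Qed.

Lemma Ct_C_sequence : C_sequence K lt Ct.
Proof.
  intros d. split; [|split].
  - intros x Hx. apply Hx.
  - intros g Hg Hacc. destruct (Ct_cases d) as [Hd|[[Hd Hc]|[Hd Hc]]].
    + apply Ct_N; auto. split; [exact Hg|]. intros e He Hed.
      destruct (proj1 Hacc) as [b Hb]. destruct (proj2 Hacc b Hb) as (x & Hx & _ & Hxg).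
      apply Ct_N in Hx; auto. destruct Hx as [_ Hx]. specialize (Hx e He Hed). ord.
    + destruct (CA_not_acc d g Hc Hg). apply acc_pt_ext with (2 := Hacc).
      intros x. now apply Ct_A.
    + apply Ct_B; auto. apply CB_closed; auto. apply acc_pt_ext with (2 := Hacc).
      intros x. now apply Ct_B.
  - intros g. unfold upper_bound, below. split; intros H x Hx.
    + destruct (Ct_cofinal d x Hx) as (c & Hc1 & Hc2). specialize (H c Hc1). ord.
    + apply H, Hx.
Qed.

Lemma Ct_below d a x : D d -> d << a -> ~ acc_pt D a -> Ct a x -> ~ x << d.
Proof.
  intros Hd Hda Ha Hx Hxd. apply Ct_N in Hx; auto. destruct Hx as [_ Hx].
  specialize (Hx d Hd Hda). ord.
Qed.

Lemma Ct_R d : acc_pt D d -> R_set K lt Ct d.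
Proof.
  intros Hd. split; [eapply acc_pt_lim, Hd|]. intros a Hda.
  pose proof (D_closed d Hd) as HDd.
  destruct (Ct_cases a) as [Ha|[[Ha Hc]|[Ha Hc]]].
  - destruct (proj1 Hd) as [b Hb].
    assert (Hno : forall x, ~ inter K (Ct a) (below K lt d) x).
    { intros x [Hx1 Hx2]. exact (Ct_below d a x HDd Hda Ha Hx1 Hx2). }
    apply (otp_lt_of_embedding _ (fun x => x) b d Hb); intros x; [intros y|];
      intros Hx; destruct (Hno x Hx).
  - apply (CA_otp a); auto. intros x [Hx _]. now apply Ct_A.
  - destruct (CB_otp_initial a d HDd Hda) as (b & Hb & Ho). exists b. split; [exact Hb|].
    apply otp_is_ext with (2 := Ho). intros x. unfold inter. now rewrite Ct_B.
Qed.

Lemma Ct_R' d : acc_pt D d -> R'_set K lt Ct d.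
Proof.
  intros Hd. split; [now apply Ct_R|]. destruct (classic (cof d)) as [Hc|Hc].
  - apply (CA_otp d); auto. intros x Hx. now apply Ct_A.
  - destruct (CB_otp d Hd Hc) as (b & Hb & Ho). exists b. split; [exact Hb|].
    apply otp_is_ext with (2 := Ho). intros x. now rewrite Ct_B.
Qed.

(** * Weak coherence *)

Definition agree_below (e d d' : K) : Prop := forall x, x << e -> (Ct d x <-> Ct d' x).

(** The trace on [e] is a tail of [e], coded by its first element, or by [e] itself when it is
    empty. *)
Lemma few_N e : few (fun d => e << d /\ ~ acc_pt D d) (agree_below e).
Proof.
  apply (few_of_code (fun b => b <<= e) (fun d b => forall x, x << e -> (Ct d x <-> b <<= x))).
  - apply tame_le.
  - intros d [Hd Hacc]. destruct (least (fun b => b = e \/ Ct d b)) as (b & Hb & Hl).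
    { exists e. now left. }
    exists b. split; [apply Hl; now left|]. intros x Hx. split; [auto|].
    intros Hbx. destruct Hb as [->|Hb]; [ord|]. apply Ct_N in Hb; auto. apply Ct_N; auto.
    destruct Hb as [_ Hb]. split; [ord|]. intros c H1 H2. specialize (Hb c H1 H2). ord.
  - intros d d' b H H' x Hx. now rewrite H, H'.
Qed.

(** The trace on [e << d] of an omega-sequence cofinal in [d] is finite, so a list codes it. *)
Lemma few_A e : few (fun d => e << d /\ acc_pt D d /\ cof d) (agree_below e).
Proof.
  apply (few_of_code (fun l => Forall (fun x => x << e) l)
    (fun d l => forall x, x << e -> (Ct d x <-> In x l))).
  - apply tame_lists, tame_below.
  - intros d (Hd & Hacc & Hc). destruct (HsA d Hc) as [Hs1 Hs2].
    assert (Hs : forall n, sA d n << sA d (S n)) by apply Hs1.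
    destruct (Hs2 e Hd) as [N HN].
    assert (Hl : forall n, exists l, forall x,
      In x l <-> x << e /\ exists k, k < n /\ x = sA d k).
    { induction n as [|n [l IH]].
      - exists []. intros x. split; [intros []|]. intros (_ & k & H & _). inversion H.
      - destruct (classic (sA d n << e)) as [H|H].
        + exists (sA d n :: l). intros x. cbn. rewrite IH. split.
          * intros [<-|(H1 & k & H2 & H3)]; [eauto|]. split; [exact H1|]. exists k. auto.
          * intros (H1 & k & H2 & H3).
            destruct (Compare_dec.le_lt_dec n k) as [H4|H4]; [|eauto].
            left. rewrite H3. f_equal. lia.
        + exists l. intros x. rewrite IH. split; intros (H1 & k & H2 & H3);
            (split; [exact H1|]); exists k; (split; [|exact H3]); auto.
          assert (k <> n) by (intros ->; apply H; congruence). lia. }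
    destruct (Hl N) as [l Hl']. exists l. split.
    + apply Forall_forall. intros x Hx. apply Hl', Hx.
    + intros x Hx. rewrite Ct_A, Hl' by auto. split; [|intros (_ & k & _ & ->); now exists k].
      intros [k ->]. split; [exact Hx|]. exists k. split; [|reflexivity].
      destruct (Compare_dec.le_lt_dec N k) as [H|H]; [|exact H].
      pose proof (seq_le _ N k Hs H). ord.
  - intros d d' l H H' x Hx. now rewrite H, H'.
Qed.

(** The minimum defining [m] at [e'] splits at [e]: up to [e] the two branches coincide, and from
    [e] on the minima are equal by assumption. *)
Lemma m_coh d d' e e' : D e -> e << d -> e << d' -> P d e = P d' e -> m d e = m d' e ->
  D e' -> e' <<= e -> m d' e' <<= m d e'.
Proof.
  intros He Hd Hd' EP Em He' Hle.
  destruct (proj1 (Hm d e' He' ltac:(ord))) as (e1 & H1 & H2 & H3 & E).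
  destruct (classic (e1 <<= e)) as [H|H].
  - rewrite E, (P_coh d d' e e1); auto; try ord. apply (Hm d' e'); auto; ord.
  - assert (m d e <<= m d e').
    { rewrite E. apply (Hm d e); auto. ord. }
    assert (m d' e' <<= m d' e) by (apply m_mono; auto; ord). rewrite <- Em in *. ord.
Qed.

Lemma B_coh d d' e e' : D e -> e << d -> e << d' -> P d e = P d' e -> m d e = m d' e ->
  F (t d) = F (t d') -> e' <<= e -> B d e' -> B d' e'.
Proof.
  intros He Hd Hd' EP Em EF Hle (H1 & H2 & H3 & H4).
  assert (EE : forall c, D c -> c <<= e -> m d c = m d' c).
  { intros c Hc Hce. apply le_antisym.
    - apply (m_coh d' d e); auto.
    - apply (m_coh d d' e); auto. }
  split; [exact H1|]. split; [ord|]. split; [ord|].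
  intros c Hc Hlt. rewrite <- !EE; auto; ord.
Qed.

Lemma CB_coh d d' e x : D e -> e << d -> e << d' -> P d e = P d' e -> m d e = m d' e ->
  F (t d) = F (t d') -> x << e -> CB d x -> CB d' x.
Proof.
  intros He Hd Hd' EP Em EF Hx (c & Hc & Hpt).
  pose proof (proj1 (pt_range _ _ _ Hc Hpt)) as Hle.
  assert (HB : forall b, b <<= e -> (B d b <-> B d' b)).
  { intros b Hb. split; apply (B_coh _ _ e); auto. }
  assert (Hacc : acc_pt (B d) c <-> acc_pt (B d') c).
  { split; intros [H1 H2]; (split; [exact H1|]); intros b Hb;
      destruct (H2 b Hb) as (y & Hy & Hby & Hyc); exists y;
      (split; [apply HB; auto; ord|auto]). }
  exists c. split; [apply HB; auto; ord|]. unfold pt.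
  rewrite <- Hacc, <- EF, <- (P_coh d d' e c); auto; ord.
Qed.

(** If [F (t d)] is at least [e], the trace is empty. Otherwise it is determined by [P d e], [m d e]
    and [F (t d)], all of which range over tame sets. *)
Lemma few_B e : D e -> few (fun d => e << d /\ acc_pt D d /\ ~ cof d) (agree_below e).
Proof.
  intros He.
  set (Bc := fun d => e << d /\ acc_pt D d /\ ~ cof d).
  apply (few_or _ (fun d => Bc d /\ e <<= F (t d)) (fun d => Bc d /\ F (t d) << e)).
  { intros d Hd. destruct (classic (F (t d) << e)) as [H|H]; [auto|].
    left. split; [exact Hd|ord]. }
  - exists (fun _ => e). destruct (no_max e) as [a Ha]. exists a. split; [auto|].
    assert (Hno : forall d x, Bc d -> e <<= F (t d) -> x << e -> ~ Ct d x).
    { intros d x (H1 & H2 & H3) H4 Hx HC. apply Ct_B in HC; auto.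
      destruct HC as (c & Hc & Hpt). pose proof (proj1 (pt_range _ _ _ Hc Hpt)).
      destruct Hc as (_ & _ & Hc & _). ord. }
    intros d d' [Hd HF] [Hd' HF'] _ x Hx.
    pose proof (Hno d x Hd HF Hx). pose proof (Hno d' x Hd' HF' Hx). tauto.
  - apply (few_of_code
      (fun p : T * (K * K) => lev (fst p) <<= e /\ (fst (snd p) << e /\ snd (snd p) << e))
      (fun d p => (Bc d /\ F (t d) << e) /\ p = (P d e, (m d e, F (t d))))).
    + apply (tame_pair (fun y => lev y <<= e)
        (fun q : K * K => fst q << e /\ snd q << e)).
      * eapply below_level_tame, HL.
      * apply (tame_pair (fun x => x << e) (fun x => x << e)); apply tame_below.
    + intros d [Hd HF]. eexists. split; [|split; [split; [exact Hd|exact HF]|reflexivity]].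
      cbn. destruct Hd as (Hd & _ & _). rewrite P_lev by ord.
      split; [apply le_refl|]. split; [now apply m_lt|exact HF].
    + intros d d' p [[(H1 & H2 & H3) H4] ->] [[(H1' & H2' & H3') H4'] E] x Hx.
      injection E as E1 E2 E3. rewrite !Ct_B by auto.
      split; apply (CB_coh _ _ e); auto.
Qed.

Lemma Ct_weakly_coherent : weakly_coherent K lt Ct.
Proof.
  intros e. destruct (D_next e) as (e' & He' & Hlt).
  assert (H : few (fun _ => True) (agree_below e')).
  { apply (few_or _ (fun d => d <<= e') (fun d => e' << d)).
    { intros d _. destruct (classic (e' << d)) as [H|H]; [auto|left; ord]. }
    - exists (fun d => d). destruct (no_max e') as [a Ha]. exists a. split.
      + intros d Hd. ord.
      + intros d d' _ _ <- x _. tauto.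
    - apply (few_or _ (fun d => e' << d /\ ~ acc_pt D d) (fun d => e' << d /\ acc_pt D d)).
      { intros d Hd. tauto. }
      + apply few_N.
      + apply (few_or _ (fun d => e' << d /\ acc_pt D d /\ cof d)
          (fun d => e' << d /\ acc_pt D d /\ ~ cof d)).
        { intros d Hd. tauto. }
        * apply few_A.
        * now apply few_B. }
  destruct H as (h & a & H1 & H2). exists a, h. split; [auto|].
  intros d d' E x. split; intros [Hx Hxe]; (split; [|exact Hxe]);
    apply (H2 d d' I I E x); auto; ord.
Qed.

Lemma D_acc_club : exists D', club D' /\ forall d, D' d -> acc_pt D d.
Proof.
  destruct (subclub D (fun x => x) (proj1 HS)) as (D' & HD' & H).
  exists D'. split; [exact HD'|]. apply H.
Qed.

(** * Separation of non-limit points *)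

Lemma Ct_nacc_cod a x : acc_pt D a -> ~ cof a -> naccS K lt (Ct a) x ->
  exists e, B a e /\ x = cod (P a e) (F (t a)).
Proof.
  intros Ha Hc [Hx Hn]. apply Ct_B in Hx; auto.
  destruct Hx as (e & He & [[Hacc ->]|[_ ->]]); [|eauto].
  destruct Hn. apply CB_acc in Hacc. apply acc_pt_ext with (2 := Hacc).
  intros y. now rewrite Ct_B.
Qed.

(** The ingredients of the code lie below it, so if it were in [D], closure under [cod] would put it
    below itself. *)
Lemma cod_not_D d e : B d e -> ~ D (cod (P d e) (F (t d))).
Proof.
  intros (He & Hed & HF & _) HD'. pose proof (P_lev d e (lt_le _ _ Hed)) as El.
  pose proof (cod_gt (P d e) (F (t d))).
  pose proof (cod_lt (P d e) (F (t d)) _ HD' ltac:(ord) ltac:(ord)). ord.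
Qed.

(** A tail at [a] has no points below [d], an omega-sequence cofinal in [a] is bounded below [d],
    and points of [D] are never codes. In the remaining case the non-limit points on both sides are
    codes. *)
Lemma Ct_V' d : hausdorff T ltT lev -> acc_pt D d -> V'_set K lt Ct d.
Proof.
  intros HH Hd. pose proof (D_closed d Hd) as HDd. split; [eapply acc_pt_lim, Hd|].
  intros a Hda. destruct (proj1 Hd) as [z Hz].
  assert (Hvoid : (forall x, x << d -> naccS K lt (Ct d) x -> naccS K lt (Ct a) x -> False) ->
    sup_lt K lt (inter K (naccS K lt (Ct d)) (naccS K lt (Ct a))) d).
  { intros H. exists z. split; [exact Hz|]. intros x [H1 H2]. exfalso.
    apply (H x); auto. apply H1. }
  destruct (Ct_cases a) as [Ha|[[Ha Hc]|[Ha Hc]]].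
  - apply Hvoid. intros x Hxd _ [Hx _]. exact (Ct_below d a x HDd Hda Ha Hx Hxd).
  - destruct (CA_bounded a d z Hc Hz Hda) as (b & Hb1 & Hb2). exists b.
    split; [exact Hb1|]. intros x [[H1 _] [H2 _]]. apply Hb2; [now apply Ct_A|apply H1].
  - destruct (classic (cof d)) as [Hcd|Hcd].
    { apply Hvoid. intros x _ [Hx _] Hxa. apply Ct_A in Hx; auto.
      destruct (Ct_nacc_cod a x Ha Hc Hxa) as (e & He & ->).
      apply (cod_not_D a e He). now apply (CA_D d). }
    (* If [t d] lies below [t a], the second components [F (t d)] and [F (t a)] of the codes differ,
       so no code is shared. *)
    destruct (classic (P a d = t d)) as [E|E].
    + apply Hvoid. intros x _ Hx Hxa.
      destruct (Ct_nacc_cod a x Ha Hc Hxa) as (e & He & ->).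
      destruct (Ct_nacc_cod d _ Hd Hcd Hx) as (e' & He' & E').
      apply cod_inj in E'. destruct E' as [_ E'].
      apply (proj2 (proj2 HS) (t d) (t a)); rewrite ?Ht; auto.
      * apply D_closed, Ha.
      * rewrite <- E, <- P_self. apply P_lt; [exact Hda|apply le_refl].
    (* By the Hausdorff property the branches already differ at some [e0 << d]. A shared code
       carries a common restriction, so its level is at most [e0], and the code lies below any point
       [b] of [D] above [e0]. *)
    + assert (He0 : exists e0, e0 << d /\ P a e0 <> P d e0).
      { apply NNPP. intros HN. apply E. symmetry.
        assert (El : lev (t d) = lev (P a d)) by (rewrite Ht, P_lev; [reflexivity|ord]).
        apply HH; [exact El|rewrite Ht; eapply acc_pt_lim, Hd|].
        intros y Hy. assert (Hyd : lev y << d) by (rewrite <- (Ht d); now apply HL).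
        replace y with (P a (lev y)); [apply P_lt; [exact Hyd|ord]|].
        transitivity (P d (lev y)).
        - apply NNPP. intros H. apply HN. eauto.
        - apply (leT_eq T ltT lev HL (t d)); [apply P_le; ord|now left|].
          rewrite P_lev; ord. }
      destruct He0 as (e0 & He0 & Hne). destruct (proj2 Hd e0 He0) as (b & Hb & Heb & Hbd).
      exists b. split; [exact Hbd|]. intros x [Hx Hxa].
      destruct (Ct_nacc_cod a x Ha Hc Hxa) as (e & He & ->).
      destruct (Ct_nacc_cod d _ Hd Hcd Hx) as (e' & He' & E').
      apply cod_inj in E'. destruct E' as [EP EF].
      pose proof (P_lev a e (lt_le _ _ (proj1 (proj2 He)))) as L1.
      pose proof (P_lev d e' (lt_le _ _ (proj1 (proj2 He')))) as L2.
      rewrite EP, L2 in L1. subst e'.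
      assert (Hee : e <<= e0).
      { apply not_lt. intros H. apply Hne. destruct He as (_ & He & _), He' as (_ & He' & _).
        apply (P_coh a d e e0); auto; ord. }
      left. apply cod_lt; [exact Hb| |].
      * rewrite EP, L2. ord.
      * destruct He as (_ & _ & HF & _). ord.
Qed.

End FromTree.

Lemma tree_square (T : Type) (ltT : T -> T -> Prop) lev F D :
  leveled T ltT lev -> special_on T ltT lev F D ->
  exists C, square_lt_seq K lt C /\
   (hausdorff T ltT lev -> contains_club K lt (fun d => R'_set K lt C d /\ V'_set K lt C d)).
Proof.
  intros HL HS0.
  destruct (res_ex T ltT lev HL) as [res Hres].
  destruct (node_code_ex T ltT lev HL) as (cT & cT_gt & cT_inj).
  destruct pairing_ex as (pr & pr_gt & pr_inj).
  set (cod := fun y v => pr (cT y) v).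
  destruct (func_choice (fun e c => forall y v, lev y <<= e -> v <<= e -> cod y v << c))
    as [h Hh].
  { intros e. destruct (tame_pair _ _ (below_level_tame T ltT lev HL e) (tame_le e)
      (fun p => cod (fst p) (snd p))) as [c Hc].
    exists c. intros y v Hy Hv. apply (Hc (y, v)). now split. }
  (* Thinning the club makes its points limits closed under [cod], while [F] stays regressive and
     injective along branches on the smaller set of levels. *)
  destruct (subclub D h (proj1 HS0)) as (D' & HD' & HD'').
  assert (HS : special_on T ltT lev F D').
  { apply special_on_subclub with (1 := HS0); [exact HD'|]. apply HD''. }
  destruct (func_choice _ (level_ex T ltT lev HL)) as [t Ht].
  set (P := fun d e => res (t d) e).
  destruct (func_choice (fun (p : K * K) v => D' (snd p) -> snd p << fst p ->
    (exists e', D' e' /\ snd p <<= e' /\ e' << fst p /\ v = F (P (fst p) e')) /\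
    forall e', D' e' -> snd p <<= e' -> e' << fst p -> v <<= F (P (fst p) e'))) as [m Hm].
  { intros [d e]; cbn. destruct (classic (D' e /\ e << d)) as [[H1 H2]|HN];
      [|exists d; tauto].
    destruct (least (fun v => exists e', D' e' /\ e <<= e' /\ e' << d /\ v = F (P d e')))
      as (v & Hv & Hl).
    { exists (F (P d e)), e. repeat split; auto. apply le_refl. }
    exists v. intros _ _. split; [exact Hv|]. intros e' H3 H4 H5. apply Hl. eauto. }
  destruct K_inh as [k0 _].
  destruct (func_choice_on (fun _ => k0) (cof D') (cof_seq D')) as [sA HsA]; [auto|].
  assert (D'_lim : forall d, D' d -> acc_kappa d).
  { intros d Hd. eapply acc_pt_lim. apply HD''. exact Hd. }
  assert (cod_inj : forall y v y' v', cod y v = cod y' v' -> y = y' /\ v = v').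
  { intros y v y' v' E. apply pr_inj in E. destruct E as [E1 E2]. auto. }
  assert (cod_gt : forall y v, lev y << cod y v).
  { intros y v. pose proof (cT_gt y). pose proof (proj1 (pr_gt (cT y) v)). unfold cod. ord. }
  assert (cod_lt : forall y v d, D' d -> lev y << d -> v << d -> cod y v << d).
  { intros y v d Hd Hy Hv. destruct (HD'' d Hd) as (_ & _ & H).
    assert (He : exists e, e << d /\ lev y <<= e /\ v <<= e).
    { destruct (lim_gt2 d _ _ (D'_lim d Hd) Hy Hv) as (e & H1 & H2 & H3).
      exists e. repeat split; ord. }
    destruct He as (e & He & H1 & H2). specialize (H e He). specialize (Hh e y v H1 H2). ord. }
  set (C := Ct T F D' res cod t (fun d e => m (d, e)) sA).
  assert (Hm' : forall d e, D' e -> e << d ->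
    (exists e', D' e' /\ e <<= e' /\ e' << d /\ m (d, e) = F (P d e')) /\
    forall e', D' e' -> e <<= e' -> e' << d -> m (d, e) <<= F (P d e')).
  { intros d e. apply (Hm (d, e)). }
  destruct (D_acc_club T ltT lev F D' HS) as (D'' & HD3 & HD4).
  assert (HR' : forall d, D'' d -> R'_set K lt C d).
  { intros d Hd. eapply Ct_R'; eauto. }
  exists C. split; [split; [|split]|].
  - eapply Ct_C_sequence; eauto.
  - eapply Ct_weakly_coherent; eauto.
  - exists D''. split; [exact HD3|]. intros d Hd. apply HR', Hd.
  - intros HH. exists D''. split; [exact HD3|]. intros d Hd. split; [auto|].
    eapply Ct_V'; eauto.
Qed.

End Kappa.

Theorem theorem10p1 (K : Type) (lt : K -> K -> Prop)
  (HK : regular_uncountable K lt) :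
  ((exists C : K -> K -> Prop, square_lt_seq K lt C /\
      contains_club K lt (fun d => R'_set K lt C d /\ V'_set K lt C d))
   <-> square_lt K lt)
  /\
  (square_lt K lt <->
   exists (T : Type) (ltT : T -> T -> Prop),
     aronszajn K lt T ltT /\ special K lt T ltT).
Proof.
  (* The implication from (2) to (1) passes through the tree of walks, which is Hausdorff. An
     arbitrary special tree yields only (2) directly. *)
  assert (H12 : square_lt K lt -> exists C, square_lt_seq K lt C /\
      contains_club K lt (fun d => R'_set K lt C d /\ V'_set K lt C d)).
  { intros H. destruct (square_lt_tree K lt HK H) as (T & ltT & lev & F & D & HL & HS & HH).
    destruct (tree_square K lt HK T ltT lev F D HL HS) as (C & HC & HV). eauto. }
  split; split.
  - intros (C & HC & _). now exists C.
  - exact H12.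
  - intros H. destruct (square_lt_tree K lt HK H) as (T & ltT & lev & F & D & HL & HS & _).
    exists T, ltT. split.
    + eapply special_on_aronszajn; eauto.
    + eapply special_on_special; eauto.
  - intros (T & ltT & [Ht _] & Hs).
    destruct (kappa_tree_leveled K lt HK T ltT Ht) as [lev HL].
    destruct (special_special_on K lt HK T ltT lev HL Hs) as (F & D & HS).
    destruct (tree_square K lt HK T ltT lev F D HL HS) as (C & HC & _). now exists C.
Qed.
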